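(* Let $m\ge3$ and $0\le k\le m-1$. Let $F=(f_1,\dots,f_{m-1},f_m):\mathbb{C}^m\to\mathbb{R}^m$ be defined by $$f_j=\begin{cases}|z_j|^2+|z_m|^2,& j=1,\dots,k,\\ |z_j|^2-|z_m|^2,& j=k+1,\dots,m-1,\end{cases}\qquad f_m=\begin{cases}\mathrm{Re}(z_1\cdots z_m),&\text{if }m\text{ is even},\\ \mathrm{Im}(z_1\cdots z_m),&\text{if }m\text{ is odd}.\end{cases}$$ Set $D=\{z\in\mathbb{C}^m:\det(\partial f_i/\partial\overline{z}_j)=0\}$. Let $M_c=F^{-1}(c)$ be the inverse image of a point $c\in\big((\mathbb{R}^+)^k\times\mathbb{R}^{m-k}\big)\setminus F(D)$, where $\mathbb{R}^+=\{x\in\mathbb{R}:x>0\}$. Then $M_c$, with a suitable choice of orientation, is an indefinite special Lagrangian submanifold of $C_k^m$.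
   Context: $C_k^m$ denotes $\mathbb{C}^m=\mathbb{R}^{2m}$ with coordinates $z_j=x_j+iy_j$, metric $g_{(2k,2m)}=\sum_{j}\varepsilon_j(dx_j^2+dy_j^2)$ and symplectic form $\omega_{(k,m)}=\sum_{j}\varepsilon_j\,dx_j\wedge dy_j$, with $\varepsilon_j=-1$ for $j\le k$ and $\varepsilon_j=1$ for $j\ge k+1$. A real $m$-dimensional submanifold $M$ is Lagrangian if $\omega_{(k,m)}|_M\equiv0$ and the metric induced by $g_{(2k,2m)}$ on $M$ is non-degenerate. An oriented Lagrangian submanifold $M$ is indefinite special Lagrangian if $dz_1\wedge\cdots\wedge dz_m(e_1,\dots,e_m)=1$ for every positively oriented Lorentz basis $e_1,\dots,e_m$ of every $T_pM$ (Lorentz basis: $g_{(2k,2m)}(e_j,e_l)=\varepsilon_j\delta_{jl}$). *)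

(* Defs.v *)
From mathcomp Require Import all_boot all_order all_algebra.
From mathcomp Require Import all_classical all_reals all_analysis.
From mathcomp Require Import complex.

Set Implicit Arguments.
Unset Strict Implicit.
Unset Printing Implicit Defensive.

Import Order.TTheory GRing.Theory Num.Theory.
Import numFieldNormedType.Exports.

Local Open Scope classical_set_scope.
Local Open Scope ring_scope.
Local Open Scope complex_scope.

(** * Submanifolds of R^N *)

(* On an open set U, being of class C^(r+1) amounts to being differentiable
   with all directional derivatives of class C^r. *)
Fixpoint Cr_on (R : realType) (V W : normedModType R) (r : nat)
    (U : set V) (f : V -> W) : Prop :=
  if r is r'.+1 then
    (forall x, U x -> differentiable f x) /\
    (forall v, Cr_on r' U (fun x => 'D_v f x))
  else forall x, U x -> {for x, continuous f}.

Definition smooth_on (R : realType) (V W : normedModType R)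
    (U : set V) (f : V -> W) : Prop := forall r, Cr_on r U f.

(* [phi] restricts to a diffeomorphism from the open set U onto the open set W,
   with inverse [psi]; the values outside U and W are irrelevant. *)
Definition diffeomorphism (R : realType) (V : normedModType R)
    (U W : set V) (phi psi : V -> V) : Prop :=
  [/\ open U /\ open W,
      smooth_on U phi /\ smooth_on W psi,
      forall x, U x -> W (phi x) /\ psi (phi x) = x &
      forall y, W y -> U (psi y) /\ phi (psi y) = y].

(* The subspace R^d x {0} of R^N. *)
Definition slice (R : realType) (N d : nat) : set 'rV[R]_N :=
  [set y | forall i : 'I_N, (d <= i)%N -> y 0 i = 0].

(* Embedded smooth submanifolds of dimension d of R^N (possibly empty, possibly
   disconnected): every point has an adapted (slice) chart. *)
Definition submanifold (R : realType) (N d : nat) (M : set 'rV[R]_N) : Prop :=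
  (d <= N)%N /\
  forall p, M p -> exists (U W : set 'rV[R]_N) (phi psi : 'rV[R]_N -> 'rV[R]_N),
    [/\ U p, diffeomorphism U W phi psi &
        forall x, U x -> (M x <-> slice d (phi x))].

(* T_pM: the velocities at p of the smooth curves drawn on M. *)
Definition tangent (R : realType) (N : nat) (M : set 'rV[R]_N) (p : 'rV[R]_N) :
    set 'rV[R]_N :=
  [set v | exists (gamma : R -> 'rV[R]_N) (e : R),
    [/\ 0 < e, smooth_on `]- e, e[%classic gamma,
        forall t, t \in `]- e, e[ -> M (gamma t),
        gamma 0 = p & derive1 gamma 0 = v]].

(* A d-frame is a d x N matrix, whose rows are the vectors of the frame. *)
Definition tangent_basis (R : realType) (N d : nat) (M : set 'rV[R]_N)
    (p : 'rV[R]_N) (B : 'M[R]_(d, N)) : Prop :=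
  row_free B /\ forall v, tangent M p v <-> (v <= B)%MS.

(* An orientation assigns to each p in M a set [o p] of bases of T_pM, said to
   be positively oriented, which is a class of bases modulo changes of basis of
   positive determinant; it depends continuously on p in the sense that M is
   locally covered by continuous positively oriented frames.  The values of [o]
   outside M are irrelevant. *)
Definition orientation (R : realType) (N d : nat) (M : set 'rV[R]_N)
    (o : 'rV[R]_N -> set 'M[R]_(d, N)) : Prop :=
  forall p, M p ->
    (exists2 B, tangent_basis M p B &
       o p = [set A *m B | A in [set A : 'M[R]_d | 0 < \det A]]) /\
    (exists (U : set 'rV[R]_N) (E : 'rV[R]_N -> 'M[R]_(d, N)),
       [/\ open U, U p, {within U `&` M, continuous E} &
           forall q, U q -> M q -> o q (E q)]).

(** * The space C_k^m = R^(2m) *)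

(* Points and tangent vectors are row vectors (x_1,...,x_m,y_1,...,y_m). *)
Notation Cspace R m := 'rV[R]_(m + m).

Definition xcoord (R : realType) (m : nat) (p : Cspace R m) (j : 'I_m) : R :=
  p 0 (lshift m j).
Definition ycoord (R : realType) (m : nat) (p : Cspace R m) (j : 'I_m) : R :=
  p 0 (rshift m j).
Definition zcoord (R : realType) (m : nat) (p : Cspace R m) (j : 'I_m) : R[i] :=
  xcoord p j +i* ycoord p j.

(* Indices start at 0, so that the coordinates j <= k become j < k. *)
Definition eps (R : realType) (k m : nat) (j : 'I_m) : R :=
  if (j < k)%N then -1 else 1.

Definition gmetric (R : realType) (k m : nat) (u v : Cspace R m) : R :=
  \sum_(j < m) eps R k j * (xcoord u j * xcoord v j + ycoord u j * ycoord v j).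

Definition omega (R : realType) (k m : nat) (u v : Cspace R m) : R :=
  \sum_(j < m) eps R k j * (xcoord u j * ycoord v j - ycoord u j * xcoord v j).

(* (dz_1 /\ ... /\ dz_m)(e_1, ..., e_m) *)
Definition dz_wedge (R : realType) (m : nat) (e : 'M[R]_(m, m + m)) : R[i] :=
  \det (\matrix_(i < m, j < m) zcoord (row i e) j).

Definition lagrangian (R : realType) (k m : nat) (M : set (Cspace R m)) : Prop :=
  [/\ submanifold m M,
      forall p u v, M p -> tangent M p u -> tangent M p v -> omega k u v = 0 &
      forall p u, M p -> tangent M p u ->
        (forall v, tangent M p v -> gmetric k u v = 0) -> u = 0].

Definition lorentz (R : realType) (k m : nat) (e : 'M[R]_(m, m + m)) : Prop :=
  forall j l : 'I_m, gmetric k (row j e) (row l e) = eps R k j * (j == l)%:R.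

Definition special_lagrangian (R : realType) (k m : nat) (M : set (Cspace R m))
    (o : Cspace R m -> set 'M[R]_(m, m + m)) : Prop :=
  [/\ lagrangian k M, orientation M o &
      forall p e, M p -> o p e -> lorentz k e -> dz_wedge e = 1].

(** * The map F : C^m -> R^m, for m = n + 1 *)

Definition Fmap (R : realType) (k n : nat) (p : Cspace R n.+1) : 'rV[R]_n.+1 :=
  \row_(j < n.+1)
    if (j < k)%N then
      Normc.normc (zcoord p j) ^+ 2 + Normc.normc (zcoord p ord_max) ^+ 2
    else if (j < n)%N then
      Normc.normc (zcoord p j) ^+ 2 - Normc.normc (zcoord p ord_max) ^+ 2
    else if odd n.+1 then complex.Im (\prod_(i < n.+1) zcoord p i)
    else complex.Re (\prod_(i < n.+1) zcoord p i).

(* The Wirtinger derivative of h with respect to the conjugate of z_j. *)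
Definition dbar (R : realType) (m : nat) (h : Cspace R m -> R) (j : 'I_m)
    (p : Cspace R m) : R[i] :=
  ('D_(delta_mx 0 (lshift m j)) h p +i* 'D_(delta_mx 0 (rshift m j)) h p) / 2.

Definition Dset (R : realType) (k n : nat) : set (Cspace R n.+1) :=
  [set p | \det (\matrix_(i < n.+1, j < n.+1)
                   dbar (fun q => Fmap k q 0 i) j p) = 0].

(* Main.v *)
(* Write X_j for the Hamiltonian field of f_j. The f_j are invariant under the
   torus {|t_j| = 1, t_1 ... t_m = 1} generated by X_1, ..., X_(m-1), so they
   Poisson-commute and X_1, ..., X_m span the tangent space ker dF of a regular
   fibre, on which omega vanishes. Up to constants, the matrix (dz_l(X_j)) is
   the arrow-shaped matrix (d f_j / d conj z_l) and its determinant is a real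
   multiple of Delta = sum_j eps_j |prod_(l <> j) z_l|^2; the choice of Re or Im
   for f_m is exactly what makes the multiple real. The orientation is that of
   (X_1, ..., X_(m-1), r X_m), where r is dz_1 /\ ... /\ dz_m evaluated on
   (X_1, ..., X_m), up to a positive constant. For a Lorentz basis e of a
   Lagrangian tangent space, Z = (z_l(e_j)) satisfies Z I Z^* = I with
   I = diag(eps), so |det Z| = 1, and det Z > 0 gives det Z = 1.
   That regular fibres are submanifolds with tangent space ker dF rests on the
   inverse function theorem, obtained from Banach's fixed point theorem. *)

From HB Require Import structures.
Require Import Defs.
From mathcomp Require Import all_boot all_order all_algebra.
From mathcomp Require Import all_classical all_reals all_analysis.
From mathcomp Require Import complex ring.

Set Implicit Arguments.
Unset Strict Implicit.
Unset Printing Implicit Defensive.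

Import Order.TTheory GRing.Theory Num.Theory.
Import numFieldNormedType.Exports.

Local Open Scope classical_set_scope.
Local Open Scope ring_scope.

(** * Calculus of C^r functions *)

Section Differentiability.
Variables (R : realType) (V W : normedModType R).

(** Trades the little-o of the differential for an explicit estimate, the form in which locally
    equal functions and inverse maps are differentiated below. *)
Lemma is_diff_epsP (f : V -> W) (df : {linear V -> W}) x : continuous df ->
  (forall e, 0 < e ->
    \forall h \near 0, `|f (h + x) - f x - df h| <= e * `|h|) ->
  is_diff x f df.
Proof.
move=> cdf H.
have E : f \o shift x = cst (f x) + df +o_ (nbhs (0 : V)) id.
  apply/eqaddoP => _/posnumP[e].
  by near=> h; rewrite !fctE opprD addrA; near: h; exact: H (gt0 e).
have D := diff_unique cdf E.
by apply: DiffDef => //; apply: (diff_locallyP _ _).2; rewrite D.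
Unshelve. all: by end_near. Qed.

Lemma differentiable_eps (f : V -> W) x : differentiable f x ->
  forall e, 0 < e ->
    \forall h \near 0, `|f (h + x) - f x - 'd f x h| <= e * `|h|.
Proof.
move=> /diff_locally E _/posnumP[e].
have /eqaddoP/(_ _ (gt0 e)) Ee := E.
near=> h; rewrite (_ : _ - _ = (f \o shift x - (cst (f x) + 'd f x)) h).
  by near: h; exact: Ee.
by rewrite !fctE opprD addrA.
Unshelve. all: by end_near. Qed.

Lemma near_eq_differentiable (f g : V -> W) x :
  {near x, f =1 g} -> differentiable f x -> differentiable g x.
Proof.
move=> fg df; suff [] : is_diff x g ('d f x) by [].
apply: is_diff_epsP => [|e e0]; first exact: diff_continuous.
have He := differentiable_eps df e0.
have fg0 : \forall h \near (0 : V), f (h + x) = g (h + x).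
  by move: fg; rewrite (near_shift 0) subr0.
have fgx := nbhs_singleton fg.
by near=> h; rewrite -(near fg0 h) // -fgx; near: h.
Unshelve. all: by end_near. Qed.

End Differentiability.

Section CrCalculus.
Variable R : realType.
Implicit Types (V W : normedModType R).

Lemma Cr_onW V W r (U : set V) (f : V -> W) : Cr_on r.+1 U f -> Cr_on r U f.
Proof.
elim: r f => [|r IH] f [df Df]; first by move=> x /df /differentiable_continuous.
by split=> // v; apply: IH.
Qed.

Lemma Cr_on_subset V W r (U U' : set V) (f : V -> W) :
  U' `<=` U -> Cr_on r U f -> Cr_on r U' f.
Proof.
move=> UU; elim: r f => [|r IH] f /=; first by move=> H x /UU /H.
by move=> [df Df]; split=> [x /UU /df //|v]; apply: IH.
Qed.

(** As U is open, f and g agree near each of its points, and so do their derivatives. This lets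
    ['D_v] of a compound function be replaced by a formula valid only on U. *)
Lemma eq_Cr_on V W r (U : set V) (f g : V -> W) : open U ->
  (forall x, U x -> f x = g x) -> Cr_on r U f -> Cr_on r U g.
Proof.
move=> oU; elim: r f g => [|r IH] f g fg.
  move=> H x Ux.
  have N : {near x, f =1 g} by exact: filterS fg (open_nbhs_nbhs (conj oU Ux)).
  have : f @ x --> f x by exact: H.
  rewrite fg // => C; apply: cvg_trans C.
  by apply: near_eq_cvg; apply: filterS N => y ->.
have N x : U x -> {near x, f =1 g}.
  by move=> Ux; exact: filterS fg (open_nbhs_nbhs (conj oU Ux)).
move=> [df Df]; split=> [x Ux|v].
  exact: near_eq_differentiable (N x Ux) (df x Ux).
by apply: IH (Df v) => x Ux; exact: near_eq_derive (N x Ux).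
Qed.

Lemma Cr_on_cst V W r (U : set V) (a : W) : Cr_on r U (fun=> a).
Proof.
elim: r a => [|r IH] a; first by move=> x _; exact: cst_continuous.
split=> [x _|v]; first exact: differentiable_cst.
by rewrite (_ : 'D_v _ = fun=> 0) //; apply/funext => x; exact: derive_cst.
Qed.

Lemma Cr_on_lin V W r (U : set V) (f : {linear V -> W}) :
  continuous f -> Cr_on r U f.
Proof.
move=> cf; case: r => [|r]; first by move=> x _; exact: cf.
split=> [x _|v]; first exact: linear_differentiable.
rewrite (_ : 'D_v _ = fun=> f v); first exact: Cr_on_cst.
by apply/funext => x; rewrite deriveE ?diff_lin //; exact: linear_differentiable.
Qed.

Lemma Cr_onD V W r (U : set V) (f g : V -> W) : open U ->
  Cr_on r U f -> Cr_on r U g -> Cr_on r U (fun x => f x + g x).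
Proof.
move=> oU; elim: r f g => [|r IH] f g.
  by move=> cf cg x Ux; apply: continuousD; [exact: cf|exact: cg].
move=> [df Df] [dg Dg]; split=> [x Ux|v].
  by apply: differentiableD; [exact: df|exact: dg].
apply: eq_Cr_on (IH _ _ (Df v) (Dg v)) => // x Ux.
by rewrite deriveD //; apply: diff_derivable; [exact: df|exact: dg].
Qed.

Lemma Cr_on_sum V W r (U : set V) (I : Type) (s : seq I) (P : pred I)
    (f : I -> V -> W) : open U ->
  (forall i, Cr_on r U (f i)) -> Cr_on r U (fun x => \sum_(i <- s | P i) f i x).
Proof.
move=> oU H; elim: s => [|i s IH].
  under eq_fun do rewrite big_nil; exact: Cr_on_cst.
under eq_fun do rewrite big_cons; case: (P i) => //; exact: Cr_onD.
Qed.

Lemma Cr_onM V r (U : set V) (f g : V -> R) : open U ->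
  Cr_on r U f -> Cr_on r U g -> Cr_on r U (fun x => f x * g x).
Proof.
move=> oU; elim: r f g => [|r IH] f g.
  by move=> cf cg x Ux; apply: continuousM; [exact: cf|exact: cg].
move=> Hf Hg; have [df Df] := Hf; have [dg Dg] := Hg; split=> [x Ux|v].
  by apply: differentiableM; [exact: df|exact: dg].
have := Cr_onD oU (IH _ _ (Cr_onW Hf) (Dg v)) (IH _ _ (Cr_onW Hg) (Df v)).
apply: eq_Cr_on => // x Ux.
by rewrite deriveM //; apply: diff_derivable; [exact: df|exact: dg].
Qed.

Lemma Cr_onN V r (U : set V) (f : V -> R) : open U ->
  Cr_on r U f -> Cr_on r U (fun x => - f x).
Proof.
move=> oU Hf; under eq_fun do rewrite -mulN1r.
by apply: Cr_onM => //; exact: Cr_on_cst.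
Qed.

Lemma Cr_on_prod V r (U : set V) (I : Type) (s : seq I) (P : pred I)
    (f : I -> V -> R) : open U ->
  (forall i, Cr_on r U (f i)) -> Cr_on r U (fun x => \prod_(i <- s | P i) f i x).
Proof.
move=> oU H; elim: s => [|i s IH].
  under eq_fun do rewrite big_nil; exact: Cr_on_cst.
under eq_fun do rewrite big_cons; case: (P i) => //; exact: Cr_onM.
Qed.

Lemma Cr_onV V r (U : set V) (f : V -> R) : open U ->
  (forall x, U x -> f x != 0) -> Cr_on r U f -> Cr_on r U (fun x => (f x)^-1).
Proof.
move=> oU f0; elim: r => [|r IH].
  by move=> cf x Ux; apply: continuousV; [exact: f0|exact: cf].
move=> Hf; have [df Df] := Hf; split=> [x Ux|v].
  by apply: differentiableV; [exact: df|exact: f0].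
(* Bootstrapping: the derivative of 1/f is -(1/f)^2 times that of f, and 1/f is already of class
   C^r. *)
have Hi := IH (Cr_onW Hf).
have := Cr_onM oU (Cr_onN oU (Cr_onM oU Hi Hi)) (Df v).
apply: eq_Cr_on => // x Ux; rewrite deriveV; last exact/diff_derivable/df.
- by rewrite -expr2 exprVn.
- exact: f0.
Qed.

Lemma Cr_on_det V r (U : set V) n (A : V -> 'M[R]_n) : open U ->
  (forall i j, Cr_on r U (fun x => A x i j)) -> Cr_on r U (fun x => \det (A x)).
Proof.
move=> oU H; apply: Cr_on_sum => // s; apply: Cr_onM => //.
  exact: Cr_on_cst.
exact: Cr_on_prod.
Qed.

(** By Cramer's rule the entries of the inverse are cofactors divided by the determinant. *)
Lemma Cr_on_invmx V r (U : set V) n (A : V -> 'M[R]_n) : open U ->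
  (forall x, U x -> A x \in unitmx) ->
  (forall i j, Cr_on r U (fun x => A x i j)) ->
  forall i j, Cr_on r U (fun x => invmx (A x) i j).
Proof.
move=> oU uA H i j.
suff S : Cr_on r U (fun x => (\det (A x))^-1 * (\adj (A x)) i j).
  by apply: eq_Cr_on S => // x Ux; rewrite /invmx uA // !mxE.
apply: Cr_onM => //.
  apply: Cr_onV => // [x Ux|]; last exact: Cr_on_det.
  by have := uA x Ux; rewrite unitmxE unitfE.
under eq_fun do rewrite mxE; apply: Cr_onM => //; first exact: Cr_on_cst.
apply: Cr_on_det => // a b; under eq_fun do rewrite !mxE; exact: H.
Qed.

Lemma differentiable_mxP V m n (f : V -> 'M[R]_(m, n)) x :
  differentiable f x <-> forall i j, differentiable (fun y => f y i j) x.
Proof.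
split=> [df i j|H].
  exact: (differentiable_comp df (differentiable_coord _ i j)).
rewrite (_ : f = \sum_(i < m) \sum_(j < n) (fun y => f y i j *: delta_mx i j)).
  do 2![apply: differentiable_sum => ?]; exact/differentiableZl/H.
apply/funext => y; rewrite [LHS]matrix_sum_delta fct_sumE.
by apply: eq_bigr => i _; rewrite fct_sumE.
Qed.

Lemma cvg_sumr (T : Type) (F : set_system T) {FF : Filter F} V (I : Type)
    (s : seq I) (f : I -> T -> V) (l : I -> V) :
  (forall i, f i @ F --> l i) ->
  \sum_(i <- s) f i x @[x --> F] --> \sum_(i <- s) l i.
Proof.
move=> H; elim: s => [|i s IH].
  by rewrite big_nil; under eq_fun do rewrite big_nil; exact: cvg_cst.
rewrite big_cons; under eq_fun do rewrite big_cons.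
by apply: cvgD; [exact: H|exact: IH].
Qed.

Lemma continuous_mxP (T : topologicalType) m n (f : T -> 'M[R]_(m, n)) x :
  {for x, continuous f} <-> forall i j, {for x, continuous (fun y => f y i j)}.
Proof.
split=> [cf i j|H].
  by apply: (@continuous_comp _ _ _ f (fun M => M i j)); [exact: cf|exact: coord_continuous].
rewrite (_ : f = fun y => \sum_(i < m) \sum_(j < n) f y i j *: delta_mx i j).
  do 2![apply: cvg_sumr => ?].
  by apply: cvgZr_tmp; exact: H.
by apply/funext => y; rewrite [LHS]matrix_sum_delta.
Qed.

Lemma derive_coord V m n (f : V -> 'M[R]_(m, n)) x v i j :
  differentiable f x -> 'D_v (fun y => f y i j) x = ('D_v f x) i j.
Proof. by move=> df; rewrite derive_mx ?mxE //; exact: diff_derivable. Qed.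

Lemma Cr_on_mxP V r (U : set V) m n (f : V -> 'M[R]_(m, n)) : open U ->
  Cr_on r U f <-> forall i j, Cr_on r U (fun x => f x i j).
Proof.
move=> oU; elim: r f => [|r IH] f.
  split=> [H i j x Ux|H x Ux]; first exact: (continuous_mxP _ _).1 (H x Ux) i j.
  by apply/continuous_mxP => i j; exact: H.
split=> [[df Df] i j|H].
  split=> [x Ux|v]; first exact: (differentiable_mxP _ _).1 (df x Ux) i j.
  apply: eq_Cr_on ((IH _).1 (Df v) i j) => // x Ux.
  by rewrite derive_coord //; exact: df.
have df x : U x -> differentiable f x.
  by move=> Ux; apply/differentiable_mxP => i j; exact: (H i j).1.
split=> // v; apply/IH => i j; apply: eq_Cr_on ((H i j).2 v) => // x Ux.
by rewrite derive_coord //; exact: df.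
Qed.

Lemma derive_rV n W (f : 'rV[R]_n -> W) x v : differentiable f x ->
  'D_v f x = \sum_(j < n) v 0 j *: 'D_(delta_mx 0 j) f x.
Proof.
move=> df; rewrite deriveE // [X in 'd f x X]row_sum_delta linear_sum.
by apply: eq_bigr => j _; rewrite linearZ deriveE.
Qed.

Lemma derive_comp V V' W (f : V' -> W) (g : V -> V') x v :
  differentiable g x -> differentiable f (g x) ->
  'D_v (fun y => f (g y)) x = 'D_('D_v g x) f (g x).
Proof.
move=> dg df; rewrite [LHS]deriveE; last exact: differentiable_comp.
by rewrite (diff_comp dg df) /= !deriveE.
Qed.

(** The direction ['D_v g x] of the chain rule moves with x, whereas [Cr_on] speaks of fixed
    directions. Expanding it in the standard basis leaves a sum of products, to which the induction
    applies. *)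
Lemma Cr_on_comp_real V n r (U : set V) (U' : set 'rV[R]_n)
    (f : 'rV[R]_n -> R) (g : V -> 'rV[R]_n) : open U -> open U' ->
  (forall x, U x -> U' (g x)) -> Cr_on r U' f -> Cr_on r U g ->
  Cr_on r U (fun x => f (g x)).
Proof.
move=> oU oU' gU; elim: r f => [|r IH] f.
  move=> cf cg x Ux; apply: (@continuous_comp _ _ _ g f); first exact: cg.
  exact/cf/gU.
move=> [df Df] Hg; have [dg Dg] := Hg; split=> [x Ux|v].
  by apply: (@differentiable_comp _ _ _ _ g f); [exact: dg|exact/df/gU].
have S : Cr_on r U (fun x =>
    \sum_(j < n) ('D_v g x) 0 j * 'D_(delta_mx 0 j) f (g x)).
  apply: Cr_on_sum => // j; apply: Cr_onM => //.
    exact: (Cr_on_mxP _ _ oU).1 (Dg v) 0 j.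
  by apply: (IH ('D_(delta_mx 0 j) f)) (Cr_onW Hg); exact: Df.
apply: eq_Cr_on S => // x Ux.
rewrite [RHS]derive_comp; [|exact: dg|exact/df/gU].
by rewrite [RHS]derive_rV //; exact/df/gU.
Qed.

Lemma Cr_on_comp V n m p r (U : set V) (U' : set 'rV[R]_n)
    (f : 'rV[R]_n -> 'M[R]_(m, p)) (g : V -> 'rV[R]_n) : open U -> open U' ->
  (forall x, U x -> U' (g x)) -> Cr_on r U' f -> Cr_on r U g ->
  Cr_on r U (fun x => f (g x)).
Proof.
move=> oU oU' gU Hf Hg; apply/Cr_on_mxP => // i j.
apply: (Cr_on_comp_real (f := fun y => f y i j) oU oU' gU) => //.
exact: (Cr_on_mxP _ _ oU').1 Hf i j.
Qed.

End CrCalculus.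

(** * Inverse function theorem *)

Section MatrixNorm.
Variable R : realType.

Lemma coord_le_norm m n (A : 'M[R]_(m, n)) i j : `|A i j| <= `|A|.
Proof.
by rewrite [leRHS]mx_normrE; exact: (le_bigmax _ (fun ij => `|A ij.1 ij.2|) (i, j)).
Qed.

Lemma norm_le_coord m n (A : 'M[R]_(m, n)) e : 0 <= e ->
  (forall i j, `|A i j| <= e) -> `|A| <= e.
Proof.
by move=> e0 H; rewrite [leLHS]mx_normrE; apply: bigmax_le => // -[i j] _.
Qed.

Lemma norm_mulmx_le m n (v : 'rV[R]_m) (A : 'M[R]_(m, n)) e :
  (forall i j, `|A i j| <= e) -> 0 <= e -> `|v *m A| <= m%:R * e * `|v|.
Proof.
move=> H e0; apply: norm_le_coord => [|i j]; first by rewrite !mulr_ge0.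
rewrite mxE (le_trans (ler_norm_sum _ _ _)) //.
rewrite -mulrA -[m in m%:R]card_ord mulr_natl -sumr_const ler_sum // => k _.
by rewrite normrM mulrC ler_pM // coord_le_norm.
Qed.

Lemma mulmxr_continuous m n (A : 'M[R]_(m, n)) :
  continuous (fun v : 'rV[R]_m => v *m A).
Proof.
move=> v; apply/continuous_mxP => i j.
rewrite (_ : (fun w : 'rV_m => _) = fun w => \sum_k w i k * A k j).
  apply: (cvg_sumr (F := nbhs v) (f := fun k (w : 'rV_m) => w i k * A k j)) => k.
  by apply: continuousM; [exact: coord_continuous|exact: cst_continuous].
by apply/funext => w; rewrite mxE.
Qed.

End MatrixNorm.

(** Makes row vectors a complete normed space, as Banach's fixed point theorem requires. *)
HB.instance Definition _ (R : realType) m n := Complete.on 'M[R]_(m, n).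

Section InverseFunction.
Variable R : realType.

Lemma ball_segment n (p x y : 'rV[R]_n) (d t : R) :
  ball p d x -> ball p d y -> t \in `[0, 1] -> ball p d (y + t *: (x - y)).
Proof.
rewrite -!ball_normE /= in_itv /= => px py /andP[t0 t1].
have -> : p - (y + t *: (x - y)) = (1 - t) *: (p - y) + t *: (p - x).
  by rewrite !scalerBr !scalerBl !scale1r; apply/matrixP => i j; rewrite !mxE; ring.
rewrite (le_lt_trans (ler_normD _ _)) // !normrZ !ger0_norm ?subr_ge0 //.
(* The strict inequality comes from the term with factor t, so t = 0 is treated apart. *)
move: t0; rewrite le_eqVlt => /predU1P[<-|t0].
  by rewrite subr0 mul1r mul0r addr0.
have -> : d = (1 - t) * d + t * d by ring.
by apply: ler_ltD; [rewrite ler_wpM2l ?subr_ge0 // ltW|rewrite ltr_pM2l].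
Qed.

(** Mean value theorem along the segment from y to x, one coordinate of h at a time, the norm being
    the maximum of the coordinates. The factor n comes from [norm_mulmx_le]. *)
Lemma lipschitz_ball n m (h : 'rV[R]_n -> 'rV[R]_m)
    (A : 'rV[R]_n -> 'M[R]_(n, m)) (p : 'rV[R]_n) (d e : R) : 0 <= e ->
  (forall x, ball p d x -> differentiable h x) ->
  (forall x v, ball p d x -> 'D_v h x = v *m A x) ->
  (forall x, ball p d x -> forall i j, `|A x i j| <= e) ->
  forall x y, ball p d x -> ball p d y -> `|h x - h y| <= n%:R * e * `|x - y|.
Proof.
move=> e0 dh Dh Ae x y px py; apply: norm_le_coord => [|i j].
  by rewrite !mulr_ge0.
pose g (t : R) := h (y + t *: (x - y)) i j.
pose l (t : R) := y + t *: (x - y).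
have dl t : is_diff t l (fun s : R => s *: (x - y)).
  suff : is_diff t (cst y + *:%R^~ (x - y)) (0 + *:%R^~ (x - y)).
    by rewrite add0r.
  exact: is_diffD.
have Dg (t : R) : t \in `[0, 1] ->
    is_derive t 1 g (((x - y) *m A (l t)) i j).
  move=> t01; have B := ball_segment px py t01.
  have dlt : differentiable l t by [].
  have D : differentiable (h \o l) t.
    by apply: differentiable_comp => //; exact: dh.
  apply: DeriveDef.
    by apply: diff_derivable; exact: (differentiable_mxP (h \o l) t).1 D i j.
  rewrite (derive_coord (f := h \o l)) //.
  rewrite (derive_comp (f := h) (g := l)) //; last exact: dh.
  by rewrite [in X in 'D_X _ _]deriveE // diff_val scale1r Dh.
have cg : {within `[0, 1], continuous g}.
  apply: continuous_in_subspaceT => t t01.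
  apply: differentiable_continuous; apply/derivable1_diffP.
  by case: (Dg t) => //; rewrite inE in t01.
have [c c01] := @MVT R g (fun t => ((x - y) *m A (l t)) i j) 0 1 ltr01
  (fun t t01 => Dg t (subset_itv_oo_cc t01)) cg.
rewrite subr0 mulr1 /g scale0r addr0 scale1r [y + (x - y)]addrC subrK => E.
rewrite !mxE E.
apply: le_trans (norm_mulmx_le _ (Ae (l c) _) e0); first exact: coord_le_norm.
by apply: ball_segment => //; exact: subset_itv_oo_cc.
Qed.

End InverseFunction.

Section InverseFunctionTheorem.
Variables (R : realType) (n : nat).
Implicit Types (phi : 'rV[R]_n -> 'rV[R]_n) (p : 'rV[R]_n).

Lemma jacobianE m (f : 'rV[R]_n -> 'rV[R]_m) x i j : differentiable f x ->
  jacobian f x i j = 'D_(delta_mx 0 i) (fun y => f y 0 j) x.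
Proof.
by move=> df; rewrite derive_coord // deriveEjacobian // -rowE [RHS]mxE.
Qed.

Lemma Cr_on_jacobian m (f : 'rV[R]_n -> 'rV[R]_m) r (U : set 'rV[R]_n) i j :
  open U -> Cr_on r.+1 U f -> Cr_on r U (fun x => jacobian f x i j).
Proof.
move=> oU H; have [df _] := H.
have := ((Cr_on_mxP _ f oU).1 H 0 j).2 (delta_mx 0 i).
by apply: eq_Cr_on => // x Ux; rewrite jacobianE //; exact: df.
Qed.

Lemma near_unitmx_small (V : normedModType R) (J G : V -> 'M[R]_n) x0 e :
  Cr_on 0 setT J -> Cr_on 0 setT G -> J x0 \in unitmx -> G x0 = 0 -> 0 < e ->
  \forall x \near x0, J x \in unitmx /\ forall i j, `|G x i j| <= e.
Proof.
move=> cJ cG uJ G0 e0.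
have unit_near : \forall x \near x0, J x \in unitmx.
  have C : \det (J x) @[x --> x0] --> \det (J x0).
    exact: (Cr_on_det openT ((Cr_on_mxP 0 J openT).1 cJ)).
  have D0 : \det (J x0) != 0 by rewrite -unitfE -unitmxE.
  have N := cvgr_neq0 _ C D0.
  by near=> x; rewrite unitmxE unitfE; near: x; exact: N.
have small_near : \forall x \near x0, forall ij : 'I_n * 'I_n,
    `|G x ij.1 ij.2| <= e.
  apply: (filter_forall (F := nbhs x0)) => -[i j].
  have C : G x i j @[x --> x0] --> G x0 i j.
    exact: (Cr_on_mxP 0 G openT).1 cG i j x0 I.
  have N := (cvgrPdist_le _ _).1 C e e0.
  have G0ij : G x0 i j = 0 by rewrite G0 mxE.
  by near=> x; rewrite -normrN -sub0r -G0ij; near: x; exact: N.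
near=> x; split; first by near: x.
by move=> i j; exact: (near small_near x _ (i, j)).
Unshelve. all: by end_near. Qed.

Lemma near_jacobian phi p e : smooth_on setT phi -> jacobian phi p \in unitmx ->
  0 < e -> \forall x \near p, jacobian phi x \in unitmx /\
    forall i j, `|(1%:M - jacobian phi x *m invmx (jacobian phi p)) i j| <= e.
Proof.
move=> sphi uJ e0.
have cJ i j : Cr_on 0 setT (fun x => jacobian phi x i j).
  exact: (Cr_on_jacobian i j openT (sphi 1%N)).
apply: (near_unitmx_small (J := jacobian phi)
  (G := fun x => 1%:M - jacobian phi x *m invmx (jacobian phi p))) => //.
- by apply/Cr_on_mxP => //; exact: openT.
- apply/Cr_on_mxP => [|i j]; first exact: openT.
  rewrite (_ : (fun x => _) = fun x => (1%:M : 'M[R]_n) i j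
      - (\sum_k jacobian phi x i k * invmx (jacobian phi p) k j)).
    apply: Cr_onD; [exact: openT|exact: Cr_on_cst|].
    apply: Cr_onN; first exact: openT.
    apply: Cr_on_sum => [|k]; first exact: openT.
    by apply: Cr_onM; [exact: openT|exact: cJ|exact: Cr_on_cst].
  by apply/funext => x; rewrite !mxE.
- by rewrite mulmxV // subrr.
Qed.

(** With A the inverse Jacobian at p, the map x - phi x *m A has zero Jacobian at p, hence a small
    one nearby, and the mean value inequality applies. The estimate yields both injectivity and the
    contraction that solves phi x = y. *)
Lemma local_injection phi p : smooth_on setT phi -> jacobian phi p \in unitmx ->
  exists2 d, 0 < d &
    (forall x, ball p d x -> jacobian phi x \in unitmx) /\
    (forall x y, ball p d x -> ball p d y ->
      `|(x - phi x *m invmx (jacobian phi p)) -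
        (y - phi y *m invmx (jacobian phi p))| <= 2^-1 * `|x - y|).
Proof.
move=> sphi uJ; set A := invmx _.
(* Chosen so that n * e <= 1/2; [n.+1] keeps the denominator nonzero when n = 0. *)
pose e : R := (2 * n.+1%:R)^-1.
have e0 : 0 < e by rewrite invr_gt0 mulr_gt0.
have /nbhs_ballP[d /= d0 pd] := near_jacobian sphi uJ e0.
have dphi x : differentiable phi x by exact: (sphi 1%N).1.
have dA x : is_diff x (fun y : 'rV_n => y *m A) (fun y => y *m A).
  suff : is_diff x (mulmxr A) (mulmxr A) by [].
  apply: DiffDef; first exact/linear_differentiable/mulmxr_continuous.
  exact/diff_lin/mulmxr_continuous.
have dphiA x : differentiable (fun y => phi y *m A) x.
  have [dAx _] := dA (phi x).
  exact: (differentiable_comp (g := fun y : 'rV_n => y *m A) (dphi x) dAx).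
exists d; first exact: d0.
split=> [x px|x y px py]; first exact: (pd x px).1.
apply: le_trans (lipschitz_ball (h := fun x => x - phi x *m A)
  (A := fun x => 1%:M - jacobian phi x *m A) (ltW e0) _ _ _ px py) _.
- by move=> z _; apply: differentiableB; [exact: ex_diff|exact: dphiA].
- move=> z v _; rewrite deriveB; last 2 first.
  + exact: derivable_id.
  + exact: diff_derivable.
  have [dAz EA] := dA (phi z).
  rewrite derive_id (derive_comp (f := fun y : 'rV_n => y *m A) v (dphi z) dAz).
  by rewrite [in X in _ - X]deriveE // EA deriveEjacobian // mulmxBr mulmx1 mulmxA.
- by move=> z pz; exact: (pd z pz).2.
rewrite ler_wpM2r // /e invfM mulrCA ler_piMr // ler_pdivrMr ?mul1r ?ler_nat //.
Qed.

(** Newton's method with frozen derivative: for y close to phi x0, a solution of phi x = y is a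
    fixed point of x - phi x *m A + y *m A, a contraction of a closed ball around x0. *)
Lemma open_image phi p d : smooth_on setT phi -> jacobian phi p \in unitmx ->
  (forall x y, ball p d x -> ball p d y ->
      `|(x - phi x *m invmx (jacobian phi p)) -
        (y - phi y *m invmx (jacobian phi p))| <= 2^-1 * `|x - y|) ->
  open (phi @` ball p d).
Proof.
set A := invmx _ => sphi uJ H.
rewrite openE => _ [x0 /= px0 <-].
have [r sr] : exists r : {posnum R}, closed_ball x0 r%:num `<=` ball p d.
  by apply/nbhs_closedballP; apply: open_nbhs_nbhs; split => //; exact: ball_open.
have cA : (fun y => (y - phi x0) *m A) @ phi x0 --> (0 : 'rV[R]_n).
  rewrite -[X in _ --> X](mul0mx _ A) -(subrr (phi x0)).
  apply: (@continuous_comp _ _ _ (fun y => y - phi x0) (fun v => v *m A)).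
    by apply: continuousB; [exact: cvg_id|exact: cst_continuous].
  exact: mulmxr_continuous.
(* Half of the radius is spent on the displacement of y and half on the contraction, so that T below
   maps the closed ball to itself. *)
have r20 : 0 < r%:num / 2 :> R by rewrite divr_gt0.
have /cvgrPdist_le/(_ _ r20) near_y := cA.
rewrite /interior; apply: filterS near_y => y; rewrite sub0r normrN => yA.
pose T x := x - phi x *m A + y *m A.
have TK x : closed_ball x0 r%:num x -> closed_ball x0 r%:num (T x).
  move=> Kx; have := Kx; rewrite !closed_ballE // /closed_ball_ /= => x0x.
  have -> : x0 - T x = (x0 - phi x0 *m A - (x - phi x *m A)) - (y - phi x0) *m A.
    by rewrite /T mulmxBl; apply/matrixP => i j; rewrite !mxE; ring.
  rewrite (le_trans (ler_normB _ _)) //.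
  have -> : r%:num = 2^-1 * r%:num + r%:num / 2 :> R by field.
  apply: lerD => //; apply: (le_trans (H _ _ px0 (sr _ Kx))).
  by rewrite ler_wpM2l.
have TKf : {homo T : x / closed_ball x0 r%:num x >-> closed_ball x0 r%:num x}.
  by [].
have ctr : is_contraction (mkfun_fun TKf).
  have h0 : (0 : R) <= 2^-1 by [].
  exists (NngNum h0); split; first by rewrite /= invf_lt1 // ltr1n.
  move=> [a b] [/= Ka Kb]; rewrite /= /mkfun /T.
  by rewrite opprD addrACA subrr addr0; apply: H; exact: sr.
have [x Kx fx] : exists2 x, closed_ball x0 r%:num x & x = mkfun_fun TKf x.
  apply: banach_fixed_point => //; first exact: closed_ball_closed.
  by exists x0; exact: closed_ballxx.
exists x; first exact: sr.
have fT : x = T x by exact: fx.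
have : (phi x - y) *m A = x - T x.
  by rewrite /T mulmxBl; apply/matrixP => i j; rewrite !mxE; ring.
(* A fixed point satisfies (phi x - y) *m A = 0, and A is cancelled by the Jacobian at p. *)
rewrite -fT subrr => /(congr1 (mulmx^~ (jacobian phi p))).
by rewrite mulmxKV // mul0mx => /eqP; rewrite subr_eq0 => /eqP.
Qed.

End InverseFunctionTheorem.

Section LocalDiffeomorphism.
Variables (R : realType) (n : nat).
Implicit Types (phi psi : 'rV[R]_n -> 'rV[R]_n) (U W : set 'rV[R]_n).

(** The Lipschitz bound turns the remainder of phi, small against |psi (y + k) - psi y|, into one
    small against |k|; multiplying by the inverse Jacobian gives the remainder of psi. *)
Lemma is_diff_inverse phi psi W y C : open W -> W y ->
  (forall z, W z -> phi (psi z) = z) ->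
  (forall z, W z -> `|psi z - psi y| <= C * `|z - y|) ->
  differentiable phi (psi y) -> jacobian phi (psi y) \in unitmx ->
  is_diff y psi (fun v => v *m invmx (jacobian phi (psi y))).
Proof.
set x0 := psi y; set D := invmx _ => oW Wy phipsi lip dphi uJ.
suff : is_diff y psi (mulmxr D) by [].
apply: is_diff_epsP => [|e e0]; first exact: mulmxr_continuous.
(* K dominates the Lipschitz constant and L the factor n |D| K lost in the estimate; the added 1
   makes each positive. *)
pose K := `|C| + 1; have K0 : 0 < K by rewrite ltr_wpDl.
pose L := n%:R * `|D| * K + 1.
have L0 : 0 < L by rewrite ltr_wpDl ?mulr_ge0 // ltW.
have eL : 0 < e / L by rewrite divr_gt0.
have /nbhs_norm0P[d /= d0 Hd] := differentiable_eps dphi eL.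
have WW : \forall h \near (0 : 'rV[R]_n), W (h + y).
  have : nbhs y W by exact: open_nbhs_nbhs.
  by rewrite {1}(_ : nbhs y W = \forall z \near y, W z) // (near_shift 0) subr0.
have small : \forall h \near (0 : 'rV[R]_n), `|h| < d / K.
  by apply/nbhs_norm0P; exists (d / K) => //=; rewrite divr_gt0.
near=> k.
have Wk : W (k + y) by near: k.
have kd : `|k| < d / K by near: k.
pose h := psi (k + y) - x0.
have hk : `|h| <= K * `|k|.
  rewrite (le_trans (lip _ Wk)) // addrK ler_wpM2r // /K.
  by rewrite (le_trans (ler_norm C)) // lerDl.
have hd : `|h| < d by rewrite (le_lt_trans hk) // mulrC -ltr_pdivlMr.
have := Hd h hd; rewrite /h subrK phipsi // /x0 phipsi // -/x0 addrK.
rewrite -deriveE // deriveEjacobian // -/h => rho.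
have -> : h - mulmxr D k = - ((k - h *m jacobian phi x0) *m D).
  by rewrite /= mulmxBl mulmxK // opprB.
rewrite normrN (le_trans (norm_mulmx_le _ (@coord_le_norm _ _ _ D) _)) //.
apply: (@le_trans _ _ (n%:R * `|D| * (e / L * (K * `|k|)))).
  rewrite ler_wpM2l ?mulr_ge0 // (le_trans rho) // ler_wpM2l //.
  exact: ltW.
rewrite (_ : n%:R * `|D| * (e / L * (K * `|k|)) = e * (n%:R * `|D| * K / L) * `|k|); last by ring.
rewrite ler_wpM2r // ler_piMr ?(ltW e0) // ler_pdivrMr // mul1r.
by rewrite lerDl.
Unshelve. all: by end_near. Qed.

(** Bootstrapping: the derivative of psi is a smooth function of psi itself, so it is of class C^r
    as soon as psi is. *)
Lemma smooth_inverse phi psi U W : open U -> open W -> smooth_on U phi ->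
  (forall x, U x -> jacobian phi x \in unitmx) ->
  (forall y, W y -> U (psi y)) ->
  (forall y, W y ->
     is_diff y psi (fun v => v *m invmx (jacobian phi (psi y)))) ->
  smooth_on W psi.
Proof.
move=> oU oW sphi uJ WU dpsi; elim=> [|r IH].
  move=> y Wy; apply: differentiable_continuous.
  by have [] := dpsi y Wy.
split=> [y Wy|v]; first by have [] := dpsi y Wy.
have S : Cr_on r W (fun y => v *m invmx (jacobian phi (psi y))).
  apply/Cr_on_mxP => // i j.
  rewrite (_ : (fun y => _) =
    fun y => \sum_k v i k * invmx (jacobian phi (psi y)) k j); last first.
    by apply/funext => y; rewrite mxE.
  apply: Cr_on_sum => // k; apply: Cr_onM => //; first exact: Cr_on_cst.
  apply: (Cr_on_invmx (A := fun y => jacobian phi (psi y))) => //.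
    by move=> y Wy; exact/uJ/WU.
  move=> a b; apply: (Cr_on_comp_real (U' := U)
    (f := fun x => jacobian phi x a b)) => //.
  exact: Cr_on_jacobian.
apply: eq_Cr_on S => // y Wy.
by have [d E] := dpsi y Wy; rewrite deriveE // E.
Qed.

Theorem inverse_function phi p : smooth_on setT phi ->
  jacobian phi p \in unitmx ->
  exists U W psi, U p /\ diffeomorphism U W phi psi.
Proof.
move=> sphi uJ; have [d d0 [uJd inj]] := local_injection sphi uJ.
set A := invmx (jacobian phi p) in inj.
(* Since x - y is the difference of the values of the 1/2-Lipschitz map plus (phi x - phi y) *m A,
   one gets |x - y| <= |x - y| / 2 + n |A| |phi x - phi y|, whence this constant. *)
pose C := 2 * (n%:R * `|A|).
have lip x y : ball p d x -> ball p d y -> `|x - y| <= C * `|phi x - phi y|.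
  move=> px py; have := inj x y px py.
  have -> : x - phi x *m A - (y - phi y *m A) =
      (x - y) - (phi x - phi y) *m A.
    by rewrite mulmxBl; apply/matrixP => i j; rewrite !mxE; ring.
  move=> H1; have H2 := norm_mulmx_le (phi x - phi y)
    (@coord_le_norm _ _ _ A) (normr_ge0 A).
  have H3 := ler_normD ((x - y) - (phi x - phi y) *m A) ((phi x - phi y) *m A).
  rewrite subrK in H3.
  rewrite /C -mulrA -ler_pdivrMl //.
  have -> : 2^-1 * `|x - y| = `|x - y| - 2^-1 * `|x - y| by field.
  by rewrite lerBlDr (le_trans H3) // [leRHS]addrC; exact: lerD.
pose W := phi @` ball p d.
have oW : open W by exact: open_image sphi uJ inj.
(* The inverse picks a preimage in the ball; the default value p is taken only off W. *)
pose psi y := xget p [set x | ball p d x /\ phi x = y].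
have psiP y : W y -> ball p d (psi y) /\ phi (psi y) = y.
  move=> [x px <-].
  exact: (@xgetPex _ p [set z | ball p d z /\ phi z = phi x]
    (ex_intro _ x (conj px erefl))).
have sphiU : smooth_on (ball p d) phi.
  by move=> r; apply: Cr_on_subset (sphi r).
exists (ball p d), W, psi; split; first exact: ballxx.
split=> //.
- by split => //; exact: ball_open.
- split=> //; apply: (smooth_inverse (U := ball p d) (phi := phi)) => //.
  + exact: ball_open.
  + by move=> y /psiP[].
  move=> y Wy; have [By _] := psiP y Wy.
  have phipsi z : W z -> phi (psi z) = z by move=> /psiP[].
  have psi_lip z : W z -> `|psi z - psi y| <= C * `|z - y|.
    by move=> Wz; have := lip _ _ (psiP z Wz).1 By; rewrite !phipsi.
  exact: (is_diff_inverse oW Wy phipsi psi_lip ((sphi 1%N).1 _ I) (uJd _ By)).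
- move=> x px; have Wx : W (phi x) by exists x.
  split=> //; have [Bx Ex] := psiP _ Wx.
  apply/eqP; rewrite -subr_eq0 -normr_le0.
  by rewrite (le_trans (lip _ _ Bx px)) // Ex subrr normr0 mulr0.
Qed.

End LocalDiffeomorphism.

(** * Regular level sets *)

Lemma unitmx_ker0 (K : fieldType) n (A : 'M[K]_n) :
  (forall v : 'rV[K]_n, v *m A = 0 -> v = 0) -> A \in unitmx.
Proof.
move=> H; rewrite -row_free_unit -kermx_eq0; apply/eqP/row_matrixP => i.
by rewrite row0; apply: H; rewrite -row_mul mulmx_ker row0.
Qed.

Lemma rV_dot_eq0 (K : realDomainType) n (v : 'rV[K]_n) : v *m v^T = 0 -> v = 0.
Proof.
move=> /matrixP/(_ 0 0); rewrite !mxE => /eqP.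
rewrite psumr_eq0 => [/allP H|j _]; last by rewrite mxE -expr2 sqr_ge0.
apply/rowP => j; have := H j (mem_index_enum j).
by rewrite !mxE mulf_eq0 orbb => /eqP.
Qed.

Section LevelSet.
Variables (R : realType) (r d : nat).
Variables (F : 'rV[R]_(r + d) -> 'rV[R]_d) (c : 'rV[R]_d).
Hypothesis smoothF : smooth_on setT F.

Let dF x : differentiable F x. Proof. exact: (smoothF 1%N).1. Qed.

Section Chart.
Variables (p : 'rV[R]_(r + d)) (E : 'M[R]_(r, r + d)).
Hypothesis kerE : forall v, (v <= E)%MS <-> 'D_v F p = 0.

(** Candidate slice chart: the first r coordinates are scalar products with the rows of E, which
    span the kernel of dF at p, and the last d are the equations of the level set. *)
Let phi (x : 'rV[R]_(r + d)) := row_mx (x *m E^T) (F x - c).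
Let A : 'M[R]_(r + d) := row_mx E^T 0.
Let B : 'M[R]_(d, r + d) := row_mx 0 1%:M.

Let phiE : phi = fun x => mulmxr A x + mulmxr B (F x - c).
Proof.
apply/funext => x; rewrite /phi /A /B /= !mul_mx_row !mulmx0 mulmx1.
by rewrite add_row_mx addr0 add0r.
Qed.

Let smooth_phi : smooth_on setT phi.
Proof.
move=> s; rewrite phiE; apply: Cr_onD; first exact: openT.
  by apply: Cr_on_lin; exact: mulmxr_continuous.
apply: (Cr_on_comp (U' := setT) (f := mulmxr B) (g := fun x => F x - c)) => //.
- exact: openT.
- exact: openT.
- by apply: Cr_on_lin; exact: mulmxr_continuous.
- apply: Cr_onD; [exact: openT|exact: smoothF|exact: Cr_on_cst].
Qed.

Let dphi x : differentiable phi x. Proof. exact: (smooth_phi 1%N).1. Qed.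

Let derive_phi v : 'D_v phi p = row_mx (v *m E^T) ('D_v F p).
Proof.
have lin m n (M : 'M[R]_(m, n)) x : differentiable (mulmxr M : 'rV_m -> _) x.
  exact/linear_differentiable/mulmxr_continuous.
have Dlin m n (M : 'M[R]_(m, n)) x w : 'D_w (mulmxr M) x = (w : 'rV_m) *m M.
  by rewrite deriveE // diff_lin //; exact: mulmxr_continuous.
have dFc : differentiable (fun x => F x - c) p.
  by apply: differentiableB; [exact: dF|exact: differentiable_cst].
have dBF : differentiable (fun x => mulmxr B (F x - c)) p.
  exact: (differentiable_comp dFc (lin _ _ B _)).
rewrite phiE deriveD; [|exact/diff_derivable/lin|exact/diff_derivable].
rewrite Dlin (derive_comp v dFc (lin _ _ B _)) Dlin.
rewrite deriveB; [|exact/diff_derivable/dF|exact: derivable_cst].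
rewrite derive_cst subr0 /A /B !mul_mx_row !mulmx0 mulmx1.
by rewrite add_row_mx addr0 add0r.
Qed.

Let slice_row_mx (a : 'rV[R]_r) (b : 'rV[R]_d) : slice r (row_mx a b) <-> b = 0.
Proof.
split=> [H|-> i].
  apply/rowP => j; rewrite mxE -(row_mxEr a b).
  by apply: H; rewrite /= leq_addr.
by case: (split_ordP i) => j ->; rewrite ?row_mxEr ?mxE //= leqNgt ltn_ord.
Qed.

(** A vector killed by the differential of phi at p lies in the row space of E and is orthogonal to
    it, so it is zero, and the inverse function theorem makes phi a chart. The last clause serves to
    build curves of prescribed velocity. *)
Lemma level_chart : exists U W phi psi,
  [/\ U p, diffeomorphism U W phi psi,
      forall x, U x -> (F x = c <-> slice r (phi x)) &
      forall v, 'D_v F p = 0 -> slice r ('D_v phi p)].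
Proof.
have uJ : jacobian phi p \in unitmx.
  apply: unitmx_ker0 => v Jv.
  have : row_mx (v *m E^T) ('D_v F p) = row_mx 0 0.
    by rewrite row_mx0 -Jv -derive_phi deriveEjacobian.
  move=> /eq_row_mx[vE /kerE/submxP[a av]].
  have vv : v *m v^T = 0 by rewrite {2}av trmx_mul mulmxA vE mul0mx.
  exact: rV_dot_eq0 vv.
have [U [W [psi [Up D]]]] := inverse_function smooth_phi uJ.
exists U, W, phi, psi; split=> // [x _|v Dv].
  split=> [Fx|/slice_row_mx/eqP]; last by rewrite subr_eq0 => /eqP.
  by apply/slice_row_mx; rewrite Fx subrr.
by rewrite derive_phi; exact/slice_row_mx.
Qed.

End Chart.

Lemma submanifold_level :
  (forall p, F p = c ->
     exists E : 'M[R]_(r, r + d), forall v, (v <= E)%MS <-> 'D_v F p = 0) ->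
  submanifold r (F @^-1` [set c]).
Proof.
move=> H; split=> [|p Mp]; first exact: leq_addr.
have [E kerE] := H p Mp; have [U [W [phi [psi [Up D sl _]]]]] := level_chart kerE.
by exists U, W, phi, psi.
Qed.

Lemma tangent_level p (E : 'M[R]_(r, r + d)) v : F p = c ->
  (forall v, (v <= E)%MS <-> 'D_v F p = 0) ->
  tangent (F @^-1` [set c]) p v <-> 'D_v F p = 0.
Proof.
move=> Fp kerE; split=> [[gamma [e [e0 sg Mg g0 <-]]]|Dv].
  have e00 : (0 : R) \in `]- e, e[ by rewrite in_itv /= oppr_lt0 e0.
  have dg : differentiable gamma 0 by exact: (sg 1%N).1.
  (* F is constant along gamma, so its derivative in the direction of the velocity vanishes. *)
  rewrite derive1E -g0 -(derive_comp (1 : R) dg (dF _)) -(derive_cst c (0 : R) (1 : R)).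
  apply: near_eq_derive; near=> t; apply: Mg.
  near: t; apply: open_nbhs_nbhs; split; [exact: interval_open|exact: e00].
have [U [W [phi [psi [Up [[oU oW] [sphi spsi] phiK psiK] sl slD]]]]] :=
  level_chart kerE.
have [Wp psip] := phiK p Up; have sw := slD v Dv; set w := 'D_v phi p in sw.
(* Conversely, v is the velocity of the curve obtained by applying [psi] to this line, which stays
   in the slice because phi p and w lie in it. *)
pose l (t : R) := phi p + t *: w.
have sl0 : smooth_on setT l.
  move=> s; apply/Cr_on_mxP => [|i j]; first exact: openT.
  rewrite (_ : (fun x => _) = fun t => phi p i j + t * w i j).
    apply: Cr_onD; [exact: openT|exact: Cr_on_cst|].
    apply: Cr_onM; [exact: openT| |exact: Cr_on_cst].
    by apply: (Cr_on_lin s setT (f := idfun)) => x; exact: cvg_id.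
  by apply/funext => t; rewrite !mxE.
have l0 : l 0 = phi p by rewrite /l scale0r addr0.
have dl : differentiable l 0 by exact: (sl0 1%N).1.
have /nbhs_ballP[e /= e0 He] : nbhs (0 : R) (l @^-1` W).
  apply: (differentiable_continuous dl); rewrite /= l0.
  exact: open_nbhs_nbhs.
have We t : t \in `]- e, e[ -> W (l t).
  rewrite in_itv /= => te; apply: He.
  by rewrite -ball_normE /= sub0r normrN ltr_norml.
exists (fun t => psi (l t)), e; split=> //.
- move=> s; have oI : open `]- e, e[%classic by exact: interval_open.
  apply: (Cr_on_comp (U' := W) (f := psi) (g := l)) => //.
  by apply: Cr_on_subset (sl0 s).
- move=> t /We Wt; have [Ut phit] := psiK _ Wt.
  apply/(sl _ Ut); rewrite phit /l => i ri.
  by rewrite !mxE sw // mulr0 addr0; apply: (sl p Up).1.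
- by rewrite l0.
have dpsi : differentiable psi (phi p) by exact: (spsi 1%N).1.
have dphi : differentiable phi p by exact: (sphi 1%N).1.
rewrite derive1E derive_comp // ?l0 //.
have -> : 'D_1 l 0 = w.
  rewrite /l deriveD; [|exact: derivable_cst|].
    rewrite derive_cst add0r deriveE ?diff_val ?scale1r //.
  by apply: diff_derivable; exact: ex_diff.
(* The velocity is the derivative along v of psi (phi x) at p, and this composite is the identity
   near p. *)
rewrite -derive_comp // -[RHS](derive_id p v); apply: near_eq_derive.
near=> x; apply: (phiK x _).2; near: x; exact: open_nbhs_nbhs.
Unshelve. all: by end_near. Qed.

End LevelSet.

(** * Lagrangian frames of C_k^m *)

Local Open Scope complex_scope.

Section ComplexSum.
Variable R : realType.

Lemma complexReD (x y : R[i]) : complex.Re (x + y) = complex.Re x + complex.Re y.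
Proof. by case: x; case: y. Qed.

Lemma complexImD (x y : R[i]) : complex.Im (x + y) = complex.Im x + complex.Im y.
Proof. by case: x; case: y. Qed.

Lemma complexReM (x y : R[i]) : complex.Re (x * y) =
  complex.Re x * complex.Re y - complex.Im x * complex.Im y.
Proof. by case: x; case: y. Qed.

Lemma complexImM (x y : R[i]) : complex.Im (x * y) =
  complex.Re x * complex.Im y + complex.Im x * complex.Re y.
Proof. by case: x; case: y. Qed.

Lemma conjcM (x y : R[i]) : conjc (x * y) = conjc x * conjc y.
Proof. exact: rmorphM. Qed.

Lemma complexRe_sum (I : Type) (s : seq I) (P : pred I) (f : I -> R[i]) :
  complex.Re (\sum_(i <- s | P i) f i) = \sum_(i <- s | P i) complex.Re (f i).
Proof. by apply: (big_morph (@complex.Re R)) => // x y; exact: complexReD. Qed.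

Lemma complexIm_sum (I : Type) (s : seq I) (P : pred I) (f : I -> R[i]) :
  complex.Im (\sum_(i <- s | P i) f i) = \sum_(i <- s | P i) complex.Im (f i).
Proof. by apply: (big_morph (@complex.Im R)) => // x y; exact: complexImD. Qed.

Lemma complex_sum (I : Type) (s : seq I) (P : pred I) (a b : I -> R) :
  \sum_(i <- s | P i) (a i +i* b i) =
  (\sum_(i <- s | P i) a i) +i* (\sum_(i <- s | P i) b i).
Proof. by apply/eqP; rewrite eq_complex complexRe_sum complexIm_sum /= !eqxx. Qed.

End ComplexSum.

(** * The Hermitian form behind the metric and the symplectic form *)

Section HermitianForm.
Variables (R : realType) (k m : nat).
Local Notation C := R[i].
Local Notation toC := (real_complex R).
Implicit Types u v : Cspace R m.

Definition zmx d (e : 'M[R]_(d, m + m)) : 'M[C]_(d, m) :=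
  \matrix_(i, j) zcoord (row i e) j.

Definition adjmx p q (A : 'M[C]_(p, q)) : 'M[C]_(q, p) := (map_mx (@conjc R) A)^T.

Definition epsmx : 'M[C]_m := diag_mx (\row_j (eps R k j)%:C).

(** Hermitian products between two frames. By [gramE] a real Gram matrix of a frame with itself
    expresses that omega vanishes on its span. *)
Definition gram d d' (e : 'M[R]_(d, m + m)) (f : 'M[R]_(d', m + m)) :=
  zmx e *m epsmx *m adjmx (zmx f).

Lemma zmx_inj d : injective (@zmx d).
Proof.
move=> e f /matrixP ef; apply/matrixP => i j.
by case: (split_ordP j) => l ->; have := ef i l; rewrite !mxE /zcoord /xcoord
  /ycoord !mxE => -[].
Qed.

Lemma zmx_mul d d' (A : 'M[R]_(d, d')) (e : 'M[R]_(d', m + m)) :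
  zmx (A *m e) = map_mx toC A *m zmx e.
Proof.
apply/matrixP => i j; rewrite !mxE /zcoord /xcoord /ycoord !mxE.
transitivity (\sum_l (A i l * e l (lshift m j) +i* (A i l * e l (rshift m j)))).
  by rewrite complex_sum.
by apply: eq_bigr => l _; rewrite !mxE /zcoord /xcoord /ycoord !mxE; simpc.
Qed.

Lemma eps_sqr (j : 'I_m) : eps R k j * eps R k j = 1.
Proof. by rewrite /eps; case: ifP => _; rewrite ?mulrNN mulr1. Qed.

Lemma eps_neq0 (j : 'I_m) : eps R k j != 0.
Proof. by rewrite /eps; case: ifP => _; rewrite ?oppr_eq0 oner_eq0. Qed.

Lemma epsmx_unit : epsmx \in unitmx.
Proof.
rewrite unitmxE unitfE det_diag; apply/prodf_neq0 => j _.
by rewrite mxE (inj_eq (@complexI R)) eps_neq0.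
Qed.

Lemma gram_sum d d' (e : 'M[R]_(d, m + m)) (f : 'M[R]_(d', m + m)) i j :
  gram e f i j = \sum_l zmx e i l * (eps R k l)%:C * conjc (zmx f j l).
Proof.
rewrite mxE; apply: eq_bigr => l _.
by rewrite mul_mx_diag [X in X * _]mxE [X in _ * X * _]mxE [adjmx _ _ _]mxE
  [X in _ * X]mxE.
Qed.

Lemma adjmx_mul p q r (A : 'M[C]_(p, q)) (B : 'M[C]_(q, r)) :
  adjmx (A *m B) = adjmx B *m adjmx A.
Proof. by rewrite /adjmx map_mxM trmx_mul. Qed.

Lemma adjmx_toC p q (A : 'M[R]_(p, q)) : adjmx (map_mx toC A) = map_mx toC A^T.
Proof. by apply/matrixP => i j; rewrite !mxE conjc_real. Qed.

Lemma gram_mul d d' d1 d1' (A : 'M[R]_(d, d1)) (B : 'M[R]_(d', d1')) e f :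
  gram (A *m e) (B *m f) = map_mx toC A *m gram e f *m map_mx toC B^T.
Proof. by rewrite /gram !zmx_mul adjmx_mul adjmx_toC !mulmxA. Qed.

Lemma gramE d d' (e : 'M[R]_(d, m + m)) (f : 'M[R]_(d', m + m)) i j :
  gram e f i j =
  gmetric k (row i e) (row j f) -i* omega k (row i e) (row j f).
Proof.
rewrite mxE /gmetric /omega -sumrN -complex_sum; apply: eq_bigr => l _.
rewrite /adjmx /epsmx mul_mx_diag !mxE /zcoord /=; simpc.
by congr (_ +i* _); ring.
Qed.

(** * Frames independent over C with a real Gram matrix *)

Section Frame.
Variables (E : 'M[R]_(m, m + m)) (G : 'M[R]_m).
Hypotheses (EU : zmx E \in unitmx) (EG : gram E E = map_mx toC G).

Lemma adj_frame_unit : adjmx (zmx E) \in unitmx.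
Proof. by rewrite unitmx_tr map_unitmx. Qed.

Lemma frame_gram_unit : G \in unitmx.
Proof.
by rewrite -(map_unitmx toC) -EG !unitmx_mul EU epsmx_unit adj_frame_unit.
Qed.

Lemma row_free_frame : row_free E.
Proof.
rewrite -kermx_eq0; apply/eqP; apply: (map_mx_inj (f := toC)).
have := congr1 (@zmx m) (mulmx_ker E); rewrite zmx_mul => K0.
rewrite -[LHS](mulmxK EU) K0 (_ : zmx _ = 0) ?mul0mx ?map_mx0 //.
by apply/matrixP => i j; rewrite !mxE /zcoord /xcoord /ycoord !mxE.
Qed.

Lemma omega_frame u v : (u <= E)%MS -> (v <= E)%MS -> omega k u v = 0.
Proof.
move=> /submxP[a ->] /submxP[b ->]; have := gramE (a *m E) (b *m E) 0 0.
rewrite !row_id gram_mul EG -!map_mxM mxE => -[_ /eqP].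
by rewrite eq_sym oppr_eq0 => /eqP.
Qed.

(** Write v as q Z with Z = [zmx E] and q complex. As G is real, orthogonality reads Im q *m G = 0;
    as G is invertible, q is real. So the span is its own omega-orthogonal. *)
Lemma sub_frameP v : (v <= E)%MS <-> forall i, omega k v (row i E) = 0.
Proof.
split=> [vE i|H]; first by apply: omega_frame => //; exact: row_sub.
have [q qE] : exists q, q *m zmx E = zmx v.
  by exists (zmx v *m invmx (zmx E)); rewrite mulmxKV.
pose qi : 'rV[R]_m := map_mx (@complex.Im R) q.
pose qr : 'rV[R]_m := map_mx (@complex.Re R) q.
have qiG : qi *m G = 0.
  have vG : gram v E = q *m map_mx toC G by rewrite -EG /gram -qE !mulmxA.
  apply/rowP => j; have Im0 : complex.Im ((q *m map_mx toC G) 0 j) = 0.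
    by rewrite -vG gramE row_id H oppr0.
  rewrite [RHS]mxE -Im0 !mxE complexIm_sum.
  by apply: eq_bigr => l _; rewrite !mxE complexImM /= mulr0 add0r.
have qi0 : qi = 0 by rewrite -(mulmxK frame_gram_unit qi) qiG mul0mx.
apply/submxP; exists qr; apply: zmx_inj; rewrite zmx_mul -qE; congr (_ *m _).
apply/rowP => j; have := congr1 (fun M : 'rV_m => M 0 j) qi0; rewrite !mxE.
by case: (q 0 j) => a b /= ->.
Qed.

(** In the basis E the metric has matrix G, invertible as a product of invertible matrices. *)
Lemma gmetric_frame_nondeg u : (u <= E)%MS ->
  (forall v, (v <= E)%MS -> gmetric k u v = 0) -> u = 0.
Proof.
move=> uE H; have /submxP[a ua] := uE.
have aG : a *m G = 0.
  apply: (map_mx_inj (f := toC)); rewrite map_mxM -EG map_mx0.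
  have := gram_mul a 1%:M E E; rewrite mul1mx -ua trmx1 map_mx1 mulmx1 => <-.
  apply/matrixP => i j; rewrite gramE mxE ord1 row_id.
  by rewrite H ?row_sub // omega_frame ?row_sub // oppr0.
by rewrite ua -(mulmxK frame_gram_unit a) aG !mul0mx.
Qed.

Lemma lorentz_frame_det (A : 'M[R]_m) t : dz_wedge E = (t ^+ 2)%:C ->
  t != 0 -> 0 < \det A -> lorentz k (A *m E) -> dz_wedge (A *m E) = 1.
Proof.
move=> dE t0 A0 L.
have detAE : dz_wedge (A *m E) = (\det A * t ^+ 2)%:C.
  rewrite -[dz_wedge _]/(\det (zmx _)) zmx_mul det_mulmx det_map_mx.
  by rewrite -[\det (zmx E)]/(dz_wedge E) dE [RHS]rmorphM.
have GL : gram (A *m E) (A *m E) = epsmx.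
  apply/matrixP => i j; rewrite gramE L omega_frame ?submxMl //; last 2 first.
  - exact: submx_trans (row_sub _ _) (submxMl _ _).
  - exact: submx_trans (row_sub _ _) (submxMl _ _).
  by rewrite oppr0 !mxE; case: (i == j); rewrite ?mulr1 ?mulr0.
have detC : \det (adjmx (zmx (A *m E))) = (\det A * t ^+ 2)%:C.
  by rewrite det_tr det_map_mx [\det _]detAE; exact: conjc_real.
have := congr1 (@determinant _ _) GL.
(* Taking determinants in Z I Z^* = I and cancelling det I leaves (det A t^2)^2 = 1; positivity
   excludes the root -1. *)
rewrite /gram !det_mulmx detC [\det (zmx _)]detAE mulrAC.
have dD : \det epsmx != 0 by rewrite -unitfE -unitmxE epsmx_unit.
move=> /(canRL (mulfK dD)); rewrite divff // -rmorphM -expr2 => /complexI /eqP.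
rewrite sqrf_eq1 => /predU1P[E1|/eqP N1]; first by rewrite detAE E1.
have t2 : 0 < t ^+ 2 by rewrite exprn_even_gt0.
by have := mulr_gt0 A0 t2; rewrite N1 oppr_gt0 ltr10.
Qed.

End Frame.

End HermitianForm.

(** * Determinants of arrow-shaped matrices *)

Section Arrow.
Variables (A : comNzRingType) (n : nat).
Implicit Types (e z w : 'I_n.+1 -> A).

Definition cofprod z j := \prod_(l | l != j) z l.

Definition arrow_mx e z w : 'M[A]_n.+1 := \matrix_(i, j)
  if (i < n)%N then z i *+ (i == j) - e i * z ord_max *+ (j == ord_max) else w j.

Lemma mul_cofprod z j : z j * cofprod z j = \prod_l z l.
Proof. by rewrite /cofprod [RHS](bigD1 j). Qed.

Lemma ltn_neq_max (i : 'I_n.+1) : (i < n)%N = (i != ord_max).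
Proof. by rewrite -val_eqE /= ltn_neqAle -ltnS ltn_ord andbT. Qed.

Lemma sum_arrow_row e z w (i : 'I_n.+1) (f : 'I_n.+1 -> A) : (i < n)%N ->
  \sum_j arrow_mx e z w i j * f j = z i * f i - e i * z ord_max * f ord_max.
Proof.
move=> ilt; under eq_bigr do rewrite mxE ilt mulrBl.
rewrite sumrB (bigD1 i) //= eqxx mulr1n big1 ?addr0 => [|j ji]; last first.
  by rewrite eq_sym (negbTE ji) mul0r.
rewrite (bigD1 ord_max) //= eqxx mulr1n [X in _ - (_ + X)]big1 ?addr0 // => j jn.
by rewrite (negbTE jn) mul0r.
Qed.

(** Each z_j completes [cofprod z j] to the full product, so the two terms of the row cancel. The
    same vector gives the determinant and, later, the orthogonality of the last gradient to the
    others. *)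
Lemma arrow_row_cofprod e z w (i : 'I_n.+1) : e ord_max = 1 -> (i < n)%N ->
  \sum_j arrow_mx e z w i j * (e j * cofprod z j) = 0.
Proof.
move=> e1 ilt; rewrite sum_arrow_row // e1 mul1r mulrCA mul_cofprod.
by rewrite -mulrA mul_cofprod subrr.
Qed.

(** Let B be the identity with last column replaced by the vector u that the first n rows
    annihilate. The product with B is lower triangular, with diagonal entries z_i and, in the last
    place, the sum of the u_j w_j. *)
Lemma det_arrow_mul e z w : e ord_max = 1 ->
  \det (arrow_mx e z w) * cofprod z ord_max =
  (\sum_j e j * cofprod z j * w j) * cofprod z ord_max.
Proof.
move=> e1; pose u j := e j * cofprod z j.
pose B : 'M[A]_n.+1 := \matrix_(i, j) if j == ord_max then u i else (i == j)%:R.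
have detB : \det B = cofprod z ord_max.
  rewrite -det_tr det_trig => [|]; last first.
    apply/is_trig_mxP => i j ij; rewrite !mxE.
    have -> : (i == ord_max) = false.
      by apply/negbTE; rewrite -ltn_neq_max (leq_trans ij) // -ltnS.
    by rewrite eq_sym -val_eqE (ltn_eqF ij).
  rewrite (bigD1 ord_max) //= big1 => [|i ni]; last first.
    by rewrite !mxE (negbTE ni) eqxx.
  by rewrite !mxE eqxx /u e1 mul1r mulr1.
have MB i j : (arrow_mx e z w *m B) i j =
    if j == ord_max then \sum_l arrow_mx e z w i l * u l else arrow_mx e z w i j.
  rewrite mxE; under eq_bigr do rewrite [B _ _]mxE.
  case: eqP => [_|_] //; rewrite (bigD1 j) //= eqxx mulr1 big1 ?addr0 // => l lj.
  by rewrite (negbTE lj) mulr0.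
rewrite -{1}detB -det_mulmx det_trig; last first.
  apply/is_trig_mxP => i j ij; rewrite MB.
  have ilt : (i < n)%N by rewrite (leq_trans ij) // -ltnS.
  case: eqP => [_|/eqP jn]; first exact: arrow_row_cofprod.
  by rewrite mxE ilt -val_eqE (ltn_eqF ij) (negbTE jn) !mulr0n subrr.
rewrite (bigD1 ord_max) //= MB eqxx; congr (_ * _).
  by apply: eq_bigr => j _; rewrite mxE ltnn mulrC.
apply: eq_bigr => i ni; rewrite MB (negbTE ni) mxE ltn_neq_max ni eqxx.
by rewrite (negbTE ni) mulr0n subr0.
Qed.

End Arrow.

(* To divide [det_arrow_mul] by a possibly zero factor, shift the z_i by an
   indeterminate and specialise it to 0. *)
Lemma det_arrow (A : idomainType) n (e z w : 'I_n.+1 -> A) : e ord_max = 1 ->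
  \det (arrow_mx e z w) = \sum_j e j * cofprod z j * w j.
Proof.
move=> e1; pose ez i : {poly A} := (e i)%:P.
pose zz i : {poly A} := 'X + (z i)%:P.
pose ww i : {poly A} := (w i)%:P.
have ez1 : ez ord_max = 1 by rewrite /ez e1.
have zz0 : cofprod zz ord_max != 0.
  by apply/prodf_neq0 => i _; rewrite monic_neq0 // monicXaddC.
have := mulIf zz0 (det_arrow_mul zz ww ez1).
move=> /(congr1 (horner_eval 0)); rewrite -det_map_mx rmorph_sum /=.
have zz_eval i : horner_eval 0 (zz i) = z i.
  by rewrite /horner_eval /zz !hornerE.
have cof_eval j : horner_eval 0 (cofprod zz j) = cofprod z j.
  by rewrite /cofprod rmorph_prod; apply: eq_bigr => i _; exact: zz_eval.
have -> : map_mx (horner_eval 0) (arrow_mx ez zz ww) = arrow_mx e z w.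
  apply/matrixP => i j; rewrite !mxE; case: ifP => _.
    rewrite rmorphB rmorphMn rmorphMn rmorphM /=.
    by rewrite !zz_eval /ez /horner_eval hornerC.
  by rewrite /ww /horner_eval hornerC.
move=> ->; apply: eq_bigr => j _.
have cofE : (cofprod zz j).[0] = cofprod z j := cof_eval j.
by rewrite /horner_eval !hornerM cofE !hornerC.
Qed.

(** * The map F *)

Section ComplexSmooth.
Variables (R : realType) (V : normedModType R).
Implicit Types f g : V -> R[i].

(** Smoothness in the real sense, by components, so that the calculus of real-valued functions
    applies. *)
Definition csmooth f := smooth_on setT (fun x => complex.Re (f x)) /\
  smooth_on setT (fun x => complex.Im (f x)).

Lemma csmooth_cst (a : R[i]) : csmooth (fun=> a).
Proof. by split=> r; exact: Cr_on_cst. Qed.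

Lemma csmoothD f g : csmooth f -> csmooth g -> csmooth (fun x => f x + g x).
Proof.
move=> [fr fi] [gr gi]; split=> r.
  by under eq_fun do rewrite complexReD; apply: Cr_onD => //; exact: openT.
by under eq_fun do rewrite complexImD; apply: Cr_onD => //; exact: openT.
Qed.

Lemma csmoothM f g : csmooth f -> csmooth g -> csmooth (fun x => f x * g x).
Proof.
move=> [fr fi] [gr gi]; have oT := @openT V; split=> r.
  under eq_fun do rewrite complexReM; apply: Cr_onD => //; last apply: Cr_onN => //.
    exact: Cr_onM.
  exact: Cr_onM.
by under eq_fun do rewrite complexImM; apply: Cr_onD => //; exact: Cr_onM.
Qed.

Lemma csmooth_conj f : csmooth f -> csmooth (fun x => conjc (f x)).
Proof.
move=> [fr fi]; split=> r.
  rewrite (_ : (fun x => _) = fun x => complex.Re (f x)); first exact: fr.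
  by apply/funext => x; case: (f x).
rewrite (_ : (fun x => _) = fun x => - complex.Im (f x)).
  by apply: Cr_onN => //; exact: openT.
by apply/funext => x; case: (f x).
Qed.

Lemma csmooth_prod (I : Type) (s : seq I) (P : pred I) (f : I -> V -> R[i]) :
  (forall i, csmooth (f i)) -> csmooth (fun x => \prod_(i <- s | P i) f i x).
Proof.
move=> H; elim: s => [|i s IH].
  by under eq_fun do rewrite big_nil; exact: csmooth_cst.
by under eq_fun do rewrite big_cons; case: (P i) => //; exact: csmoothM.
Qed.

Lemma csmooth_differentiable f x : csmooth f ->
  differentiable (fun y => complex.Re (f y)) x /\
  differentiable (fun y => complex.Im (f y)) x.
Proof. by move=> [fr fi]; split; [exact: (fr 1%N).1|exact: (fi 1%N).1]. Qed.

End ComplexSmooth.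

(** * Derivatives of the coordinates and of their product *)

Section Coordinates.
Variables (R : realType) (m : nat).
Implicit Types p v : Cspace R m.

Lemma smooth_coord r (j : 'I_(m + m)) :
  Cr_on r setT (fun p : Cspace R m => p 0 j).
Proof.
have oT := @openT 'rV[R]_(m + m).
apply: ((Cr_on_mxP r (fun p : 'rV[R]_(m + m) => p) oT).1 _ 0 j).
by apply: (Cr_on_lin r setT (f := idfun)) => x; exact: cvg_id.
Qed.

Lemma csmooth_zcoord (j : 'I_m) : csmooth (fun p => zcoord p j).
Proof. by split=> r; exact: smooth_coord. Qed.

Lemma derive_xcoord p v (j : 'I_m) : 'D_v (fun q => xcoord q j) p = xcoord v j.
Proof.
rewrite /xcoord (derive_coord (f := fun q => q)) ?derive_id //; exact: ex_diff.
Qed.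

Lemma derive_ycoord p v (j : 'I_m) : 'D_v (fun q => ycoord q j) p = ycoord v j.
Proof.
rewrite /ycoord (derive_coord (f := fun q => q)) ?derive_id //; exact: ex_diff.
Qed.

(** Leibniz expansion of the derivative of the product along v. Lists allow the induction of
    [derive_prod]; on a [uniq] list the condition i != j drops a single factor. *)
Definition dprod (s : seq 'I_m) p v : R[i] :=
  \sum_(j <- s) zcoord v j * \prod_(i <- s | i != j) zcoord p i.

Lemma dprod_cons x s p v : x \notin s ->
  dprod (x :: s) p v =
  zcoord v x * \prod_(i <- s) zcoord p i + zcoord p x * dprod s p v.
Proof.
move=> xs; rewrite /dprod !big_cons eqxx /=; congr (_ * _ + _).
  rewrite [LHS]big_seq_cond [RHS]big_seq; apply: eq_bigl => i.
  by case: (boolP (i \in s)) => //= is_; apply: contraNneq xs => <-.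
rewrite mulr_sumr big_seq [RHS]big_seq; apply: eq_bigr => j js.
have xj : x != j by apply: contraNneq xs => ->.
by rewrite big_cons xj; exact: mulrCA.
Qed.

Lemma derive_prod (s : seq 'I_m) p v : uniq s ->
  'D_v (fun q => complex.Re (\prod_(i <- s) zcoord q i)) p =
    complex.Re (dprod s p v) /\
  'D_v (fun q => complex.Im (\prod_(i <- s) zcoord q i)) p =
    complex.Im (dprod s p v).
Proof.
elim: s => [_|x s IH /= /andP[xs us]].
  rewrite /dprod big_nil; under eq_fun do rewrite big_nil.
  split; first exact: derive_cst.
  by under eq_fun do rewrite big_nil; exact: derive_cst.
have [DR DI] := IH us.
have [dR dI] := csmooth_differentiable p (csmooth_prod s predT csmooth_zcoord).
have [dx dy] := csmooth_differentiable p (csmooth_zcoord x).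
rewrite dprod_cons // !(complexReD, complexImD, complexReM, complexImM).
have dvb (f : Cspace R m -> R) : differentiable f p -> derivable f p v.
  exact: diff_derivable.
split.
  under eq_fun do rewrite big_cons complexReM.
  rewrite deriveB; [|exact/dvb/differentiableM|exact/dvb/differentiableM].
  rewrite !deriveM; try exact: dvb.
  by rewrite DR DI derive_xcoord derive_ycoord /GRing.scale /=; ring.
under eq_fun do rewrite big_cons complexImM.
rewrite deriveD; [|exact/dvb/differentiableM|exact/dvb/differentiableM].
rewrite !deriveM; try exact: dvb.
by rewrite DR DI derive_xcoord derive_ycoord /GRing.scale /=; ring.
Qed.

End Coordinates.

(** * Derivatives of the components of F *)

Section Frame.
Variables (R : realType) (n k : nat).
Hypothesis hk : (k <= n)%N.
Local Notation C := R[i].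
Local Notation V := (Cspace R n.+1).
Local Notation epsC j := ((eps R k j)%:C : C).
Implicit Types (p v : V) (i j : 'I_n.+1).

(** Treats both parities at once: f_m is the real part of conj(phase) z_1 ... z_m, since Im w =
    Re(-i w). *)
Definition phase : C := if odd n.+1 then 'i%C else 1.

(** The matrix of the d f_i / d conj z_j, save that the factor 1/2 of the last row is left out;
    [grad_scale] accounts for it. *)
Definition grad_mx p : 'M[C]_n.+1 :=
  arrow_mx (fun j => epsC j) (fun j => zcoord p j)
    (fun j => phase * conjc (cofprod (fun i => zcoord p i) j)).

Definition grad_scale i : R := if (i < n)%N then 2 else 1.

Definition Delta p : R := \sum_j eps R k j *
  (complex.Re (cofprod (fun i => zcoord p i) j) ^+ 2 +
   complex.Im (cofprod (fun i => zcoord p i) j) ^+ 2).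

Lemma eps_max : eps R k (@ord_max n) = 1.
Proof. by rewrite /eps ltnNge hk. Qed.

Lemma epsC_max : epsC (@ord_max n) = 1.
Proof. by rewrite eps_max. Qed.

Lemma grad_scale_gt0 i : 0 < grad_scale i.
Proof. by rewrite /grad_scale; case: ifP. Qed.

Lemma mul_conjc (z : C) : z * conjc z = (complex.Re z ^+ 2 + complex.Im z ^+ 2)%:C.
Proof.
by case: z => a b; apply/eqP; rewrite eq_complex /=; apply/andP; split;
  apply/eqP; ring.
Qed.

Lemma det_grad_mx p : \det (grad_mx p) = phase * (Delta p)%:C.
Proof.
rewrite det_arrow ?epsC_max // /Delta rmorph_sum mulr_sumr.
by apply: eq_bigr => j _; rewrite rmorphM /= -mul_conjc; ring.
Qed.

Lemma Fmap_lt i p : (i < n)%N -> Fmap k p 0 i =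
  xcoord p i * xcoord p i + ycoord p i * ycoord p i - eps R k i *
    (xcoord p ord_max * xcoord p ord_max + ycoord p ord_max * ycoord p ord_max).
Proof.
have nc (z : C) : Normc.normc z ^+ 2 = complex.Re z ^+ 2 + complex.Im z ^+ 2.
  by case: z => a b; rewrite sqr_sqrtr // addr_ge0 ?sqr_ge0.
move=> ilt; rewrite mxE ilt !nc !expr2 /eps; by case: (i < k)%N; rewrite ?mulN1r ?opprK ?mul1r.
Qed.

Lemma Fmap_max p : Fmap k p 0 ord_max =
  complex.Re (conjc phase * \prod_i zcoord p i).
Proof.
rewrite mxE /= ltnn ltnNge hk /= /phase -[~~ odd n]/(odd n.+1).
case: (odd n.+1); last by rewrite conjc1 mul1r.
by rewrite complexReM /=; ring.
Qed.

Lemma ord_cases i : (i < n)%N \/ i = ord_max.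
Proof.
by rewrite ltn_neq_max; case: eqP => [|_]; [right|left].
Qed.

(** For real h, dh(v) is twice the real part of the sum of the v_j times the conjugates of the dh /
    d conj z_j. The 2 is [grad_scale], halved in the last row. *)
Lemma derive_Fmap p v i : 'D_v (fun q => Fmap k q 0 i) p =
  grad_scale i * complex.Re (\sum_j zcoord v j * conjc (grad_mx p i j)).
Proof.
have dvb (f : V -> R) : differentiable f p -> derivable f p v.
  exact: diff_derivable.
case: (ord_cases i) => [ilt|->].
  under eq_fun do rewrite Fmap_lt //.
  have dx j : differentiable (fun q : V => xcoord q j) p.
    exact: (csmooth_differentiable p (csmooth_zcoord R j)).1.
  have dy j : differentiable (fun q : V => ycoord q j) p.
    exact: (csmooth_differentiable p (csmooth_zcoord R j)).2.
  have dq j : differentiable (fun q : V =>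
      xcoord q j * xcoord q j + ycoord q j * ycoord q j) p.
    by apply: differentiableD; apply: differentiableM.
  have Dq j : 'D_v (fun q : V =>
      xcoord q j * xcoord q j + ycoord q j * ycoord q j) p =
      2 * (xcoord p j * xcoord v j + ycoord p j * ycoord v j).
    rewrite deriveD; [|exact/dvb/differentiableM|exact/dvb/differentiableM].
    rewrite !deriveM; try exact: dvb.
    by rewrite derive_xcoord derive_ycoord /GRing.scale /=; ring.
  rewrite deriveB; [|exact: dvb|exact/dvb/differentiableZ].
  rewrite deriveZ; last exact: dvb.
  rewrite !Dq /grad_scale ilt.
  have -> : \sum_j zcoord v j * conjc (grad_mx p i j) =
      conjc (zcoord p i * conjc (zcoord v i) -
       epsC i * zcoord p ord_max * conjc (zcoord v ord_max)).
    rewrite -(sum_arrow_row (fun j => epsC j) (fun j => zcoord p j)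
      (fun j => phase * conjc (cofprod (fun i => zcoord p i) j))
      (fun j => conjc (zcoord v j)) ilt) rmorph_sum.
    apply: eq_bigr => j _; rewrite [RHS]rmorphM [RHS]mulrC; congr (_ * _).
    exact/esym/conjcK.
  by rewrite /zcoord /GRing.scale /=; ring.
under eq_fun do rewrite Fmap_max complexReM.
have [DR DI] := derive_prod p v (index_enum_uniq 'I_n.+1).
have [dR dI] := csmooth_differentiable p
  (csmooth_prod (index_enum 'I_n.+1) predT (@csmooth_zcoord R n.+1)).
rewrite deriveB; [|exact/dvb/differentiableZ|exact/dvb/differentiableZ].
rewrite !deriveZ; try exact: dvb.
rewrite DR DI /grad_scale ltnn mul1r /dprod -!complexReM.
have -> : \sum_j zcoord v j * conjc (grad_mx p ord_max j) =
    conjc phase * \sum_j zcoord v j * \prod_(l | l != j) zcoord p l.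
  rewrite mulr_sumr; apply: eq_bigr => j _.
  by rewrite mxE ltnn [conjc (_ * _)]rmorphM /= conjcK mulrCA.
by rewrite complexReM.
Qed.

Lemma smooth_Fmap : smooth_on setT (@Fmap R k n).
Proof.
have oT := @openT V.
move=> r; apply/Cr_on_mxP => // i0 i; rewrite ord1 {i0}.
case: (ord_cases i) => [ilt|->]; last first.
  under eq_fun do rewrite Fmap_max.
  have cP := csmooth_prod (index_enum 'I_n.+1) predT (@csmooth_zcoord R n.+1).
  exact: (csmoothM (csmooth_cst V (conjc phase)) cP).1.
under eq_fun do rewrite Fmap_lt //.
by do ?[apply: Cr_onD => //|apply: Cr_onN => //|apply: Cr_onM => //];
  try exact: smooth_coord; exact: Cr_on_cst.
Qed.

Lemma dbar_Fmap p i j : dbar (fun q => Fmap k q 0 i) j p =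
  (grad_scale i / 2)%:C * grad_mx p i j.
Proof.
have zx l : zcoord (delta_mx 0 (lshift n.+1 j) : V) l = (l == j)%:R.
  by rewrite /zcoord /xcoord /ycoord !mxE /= (inj_eq (@lshift_inj _ _))
    eq_rlshift; case: (l == j).
have zy l : zcoord (delta_mx 0 (rshift n.+1 j) : V) l = (l == j)%:R * 'i%C.
  by rewrite /zcoord /xcoord /ycoord !mxE /= (inj_eq (@rshift_inj _ _))
    eq_lrshift; case: (l == j); simpc.
(* The directions e_j and i e_j extract the real and the imaginary part of the entry. *)
rewrite /dbar !derive_Fmap.
under eq_bigr do rewrite zx; under [in X in _ +i* X]eq_bigr do rewrite zy.
rewrite (bigD1 j) //= eqxx mul1r big1 ?addr0 => [|l /negbTE ->]; last first.
  by rewrite mul0r.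
rewrite (bigD1 j) //= eqxx mul1r big1 ?addr0 => [|l /negbTE ->]; last first.
  by rewrite !mul0r.
case: (grad_mx p i j) => a b; rewrite -[2 : C](rmorph_nat (real_complex R) 2).
rewrite -[(_)%:C^-1]fmorphV.
by apply/eqP; rewrite eq_complex /=; apply/andP; split; apply/eqP; simpc => /=; ring.
Qed.

End Frame.

(** * The Hamiltonian frame of the fibres *)

Section AdaptedFrame.
Variables (R : realType) (n k : nat).
Hypothesis hk : (k <= n)%N.
Local Notation C := R[i].
Local Notation toC := (real_complex R).
Local Notation V := (Cspace R n.+1).
Local Notation epsC j := ((eps R k j)%:C : C).
Implicit Types (p v : V) (i j : 'I_n.+1).

(** The determinant of (i eps_j g_ij), with g = [grad_mx]: it equals phase i^m times the product of
    the eps_j times Delta, and phase i^m is a sign. Scaling the last row by this very number turns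
    the determinant into a square. *)
Definition orient p : R :=
  (-1) ^+ (uphalf n.+1) * (\prod_(j < n.+1) eps R k j) * Delta k p.

Definition row_scale p i : R := if (i < n)%N then 1 else orient p.

(* Row i is a multiple of the Hamiltonian field of f_i; the factor [orient] of
   the last one makes dz_1 /\ ... /\ dz_m positive on the frame. *)
Definition cframe p : 'M[C]_n.+1 := \matrix_(i, j)
  ((row_scale p i)%:C * ('i%C * epsC j * grad_mx k p i j)).

Definition frame p : 'M[R]_(n.+1, n.+1 + n.+1) :=
  row_mx (map_mx (@complex.Re R) (cframe p)) (map_mx (@complex.Im R) (cframe p)).

Lemma cframeE p i j :
  cframe p i j = (row_scale p i)%:C * ('i%C * epsC j * grad_mx k p i j).
Proof. by rewrite mxE. Qed.

Lemma zmx_frame p : zmx (frame p) = cframe p.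
Proof.
apply/matrixP => i j; rewrite [LHS]mxE /zcoord /xcoord /ycoord.
rewrite ![row _ _ _ _]mxE row_mxEl row_mxEr ![map_mx _ _ _ _]mxE.
by case: (cframe p i j).
Qed.

Lemma phase_i : phase R n * 'i%C ^+ n.+1 = ((-1) ^+ uphalf n.+1)%:C.
Proof.
rewrite -[in X in _ ^+ X](odd_double_half n.+1) exprD -mul2n exprM sqr_i.
rewrite uphalf_half rmorphXn rmorphN1 /phase exprD mulrA.
by case: (odd n.+1); rewrite /= ?expr0 ?mulr1 // !expr1 -expr2 sqr_i.
Qed.

Lemma det_cframe p : \det (cframe p) = (orient p ^+ 2)%:C.
Proof.
have -> : cframe p = diag_mx (\row_i (row_scale p i)%:C) *m grad_mx k p *m
    diag_mx (\row_j ('i%C * epsC j)).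
  by rewrite mul_diag_mx mul_mx_diag; apply/matrixP => i j; rewrite !mxE; ring.
rewrite !det_mulmx !det_diag (det_grad_mx hk).
rewrite (bigD1 ord_max) //= big1 ?mulr1 => [|i ni]; last first.
  by rewrite mxE /row_scale ltn_neq_max ni.
under [X in _ * _ * X = _]eq_bigr do rewrite mxE.
rewrite big_split /= prodr_const card_ord mxE /row_scale ltnn -rmorph_prod /=.
set P := (\prod_(j < n.+1) eps R k j)%:C.
transitivity ((orient p)%:C * ((phase R n * 'i%C ^+ n.+1) * P * (Delta k p)%:C)).
  by ring.
by rewrite phase_i /P -!rmorphM -expr2.
Qed.

Lemma gramc_frameE p i j : gram k (frame p) (frame p) i j =
  (row_scale p i * row_scale p j)%:C *
  \sum_l epsC l * grad_mx k p i l * conjc (grad_mx k p j l).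
Proof.
rewrite gram_sum zmx_frame mulr_sumr rmorphM.
apply: eq_bigr => l _; rewrite !cframeE 3!conjcM !conjc_real.
have ee : epsC l * epsC l = 1 by rewrite -rmorphM eps_sqr.
have ii : 'i%C * conjc 'i%C = 1 :> C.
  by rewrite mul_conjc /= expr0n expr1n add0r.
transitivity ((row_scale p i)%:C * (row_scale p j)%:C *
  (('i%C * conjc 'i%C) * (epsC l * epsC l) *
   (epsC l * grad_mx k p i l * conjc (grad_mx k p j l)))).
  by ring.
by rewrite ee ii !mul1r.
Qed.

Lemma grad_mx_max p j : grad_mx k p ord_max j =
  phase R n * conjc (cofprod (fun i => zcoord p i) j).
Proof. by rewrite mxE ltnn. Qed.

(** Up to constants these are the Poisson brackets of the f_i. For i, j < n the sum is eps_i eps_j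
    |z_m|^2, plus eps_i |z_i|^2 if i = j; for one last index it vanishes by [arrow_row_cofprod]; for
    two it is a real combination of squared moduli. *)
Lemma Im_gram_grad p i j : complex.Im
  (\sum_l epsC l * grad_mx k p i l * conjc (grad_mx k p j l)) = 0.
Proof.
have Im0 (a : R) : complex.Im (a%:C : C) = 0 by [].
have mixed i' : (i' < n)%N ->
    \sum_l epsC l * grad_mx k p i' l * conjc (grad_mx k p ord_max l) = 0.
  move=> lt; transitivity (conjc (phase R n) * \sum_l grad_mx k p i' l *
      (epsC l * cofprod (fun l => zcoord p l) l)).
    rewrite mulr_sumr; apply: eq_bigr => l _.
    rewrite grad_mx_max conjcM conjcK.
    by ring.
  by rewrite arrow_row_cofprod ?mulr0 // epsC_max.
have [ilt|->] := ord_cases i; have [jlt|->] := ord_cases j.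
- have -> : \sum_l epsC l * grad_mx k p i l * conjc (grad_mx k p j l) =
      \sum_l grad_mx k p i l * (epsC l * conjc (grad_mx k p j l)).
    by apply: eq_bigr => l _; ring.
  rewrite sum_arrow_row // !mxE jlt epsC_max // mul1r.
  have jm : (j == ord_max) = false by apply/negbTE; rewrite -ltn_neq_max.
  have im : (i == ord_max) = false by apply/negbTE; rewrite -ltn_neq_max.
  rewrite jm im eqxx mulr0n subr0 mulr1n sub0r.
  case: (eqVneq j i) => [->|_]; rewrite ?mulr1n ?mulr0n.
    rewrite !complexImD /zcoord /eps.
    by case: (i < k)%N => /=; ring.
  rewrite /zcoord /eps; case: (i < k)%N; case: (j < k)%N => /=; ring.
- by rewrite mixed.
- have -> : \sum_l epsC l * grad_mx k p ord_max l * conjc (grad_mx k p j l) =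
      conjc (\sum_l epsC l * grad_mx k p j l * conjc (grad_mx k p ord_max l)).
    rewrite rmorph_sum; apply: eq_bigr => l _.
    rewrite [RHS]conjcM conjcM conjcK conjc_real.
    by ring.
  by rewrite mixed // /= oppr0.
- rewrite complexIm_sum big1 // => l _.
  by rewrite -mulrA mul_conjc -rmorphM.
Qed.

Lemma gram_frame_real p : exists G : 'M[R]_n.+1,
  gram k (frame p) (frame p) = map_mx toC G.
Proof.
exists (map_mx (@complex.Re R) (gram k (frame p) (frame p))).
apply/matrixP => i j; rewrite [RHS]mxE [in RHS]mxE gramc_frameE.
have := Im_gram_grad p i j; case: (\sum_l _) => a b /= ->.
by apply/eqP; rewrite eq_complex /= !(mulr0, mul0r, addr0, subr0) !eqxx.
Qed.

(** The factor i eps_j of [cframe] turns the pairing that computes df_i into omega. Where [orient]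
    is nonzero, the common omega-orthogonal of the rows is thus ker dF. *)
Lemma omega_frame_row p v i : omega k v (row i (frame p)) =
  row_scale p i * complex.Re (\sum_j zcoord v j * conjc (grad_mx k p i j)).
Proof.
have := congr1 (@complex.Im R) (gramE k v (frame p) 0 i).
rewrite row_id /= => /eqP; rewrite eq_sym eqr_oppLR => /eqP ->.
rewrite gram_sum zmx_frame.
transitivity (- complex.Im ((row_scale p i)%:C * (conjc 'i%C) *
    (\sum_j zcoord v j * conjc (grad_mx k p i j)))).
  congr (- complex.Im _); rewrite mulr_sumr; apply: eq_bigr => j _.
  rewrite [zmx v 0 j]mxE row_id cframeE 3!conjcM !conjc_real.
  have ee : epsC j * epsC j = 1 by rewrite -rmorphM eps_sqr.
  transitivity ((row_scale p i)%:C * conjc 'i%C * (epsC j * epsC j) *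
    (zcoord v j * conjc (grad_mx k p i j))); first by ring.
  by rewrite ee mulr1.
by case: (\sum_j _) => a b /=; ring.
Qed.

Lemma derive_Fmap_eq0 p v : 'D_v (@Fmap R k n) p = 0 <->
  forall i, 'D_v (fun q => Fmap k q 0 i) p = 0.
Proof.
have dF : differentiable (@Fmap R k n) p by exact: (smooth_Fmap R hk 1%N).1.
split=> [H i|H]; first by rewrite derive_coord // H mxE.
by apply/rowP => i; rewrite -derive_coord // H mxE.
Qed.

(** The matrix defining [Dset] is [grad_mx] with rows scaled by positive reals, so its determinant
    vanishes as soon as Delta does. *)
Lemma orient_neq0 p : ~ Dset k p -> orient p != 0.
Proof.
move=> nD; have D0 : Delta k p != 0.
  apply: contra_notN nD => /eqP D0; rewrite /Dset /=.
  have -> : \matrix_(i, j) dbar (fun q => Fmap k q 0 i) j p =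
      diag_mx (\row_i (grad_scale R i / 2)%:C) *m grad_mx k p.
    apply/matrixP => i j; rewrite [LHS]mxE dbar_Fmap //.
    by rewrite mul_diag_mx !mxE.
  by rewrite det_mulmx det_grad_mx // D0 !mulr0.
rewrite !mulf_neq0 ?signr_eq0 //.
by apply/prodf_neq0 => j _; exact: eps_neq0.
Qed.

Lemma frame_unit p : ~ Dset k p -> zmx (frame p) \in unitmx.
Proof.
move=> /orient_neq0 o0; rewrite zmx_frame unitmxE unitfE det_cframe.
by rewrite (inj_eq (@complexI R)) expf_eq0.
Qed.

(** By [sub_frameP] the span is its own omega-orthogonal, which [omega_frame_row] identifies with
    ker dF, the row factors being nonzero off D. *)
Lemma frame_kerP p : ~ Dset k p ->
  forall v, (v <= frame p)%MS <-> 'D_v (@Fmap R k n) p = 0.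
Proof.
move=> nD v; have [G EG] := gram_frame_real p.
have := sub_frameP (frame_unit nD) EG v => H.
have rs0 i : row_scale p i != 0.
  by rewrite /row_scale; case: ifP => _; rewrite ?oner_eq0 ?orient_neq0.
split=> [/H E|/derive_Fmap_eq0 E].
  apply/derive_Fmap_eq0 => i; rewrite derive_Fmap //.
  have := E i; rewrite omega_frame_row => /eqP.
  by rewrite mulf_eq0 (negbTE (rs0 i)) => /eqP ->; rewrite mulr0.
apply/H => i; rewrite omega_frame_row.
have := E i; rewrite derive_Fmap // => /eqP.
by rewrite mulf_eq0 gt_eqF ?grad_scale_gt0 // => /eqP ->; rewrite mulr0.
Qed.

Lemma csmooth_cofprod j : csmooth (fun p => cofprod (fun i => zcoord p i) j).
Proof. by apply: csmooth_prod => i; exact: csmooth_zcoord. Qed.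

Lemma smooth_orient : smooth_on setT orient.
Proof.
have oT := @openT V; move=> r; apply: Cr_onM => //; first exact: Cr_on_cst.
apply: Cr_on_sum => // j; apply: Cr_onM => //; first exact: Cr_on_cst.
have [cr ci] := csmooth_cofprod j.
under eq_fun do rewrite !expr2.
by apply: Cr_onD => //; apply: Cr_onM.
Qed.

Lemma csmooth_grad_mx i j : csmooth (fun p => grad_mx k p i j).
Proof.
case: (boolP (i < n)%N) => [ilt|/negbTE ilt]; last first.
  under eq_fun do rewrite mxE ilt.
  by apply: csmoothM; [exact: csmooth_cst|exact/csmooth_conj/csmooth_cofprod].
under eq_fun do rewrite mxE ilt.
have -> : (fun p => zcoord p i *+ (i == j) -
      epsC i * zcoord p ord_max *+ (j == ord_max)) =
    (fun p => zcoord p i * (i == j)%:R +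
      - epsC i * (j == ord_max)%:R * zcoord p ord_max).
  apply/funext => p; rewrite mulr_natr !mulNr; congr (_ - _).
  by rewrite -mulr_natr; ring.
apply: csmoothD; apply: csmoothM; by [exact: csmooth_zcoord|exact: csmooth_cst].
Qed.

Lemma continuous_frame : continuous frame.
Proof.
have so : csmooth (fun p => (orient p)%:C).
  by split; [exact: smooth_orient|move=> r; exact: Cr_on_cst].
have sc i j : csmooth (fun p => cframe p i j).
  under eq_fun do rewrite mxE.
  apply: csmoothM.
    by rewrite /row_scale; case: (i < n)%N; [exact: csmooth_cst|exact: so].
  by apply: csmoothM; [exact: csmooth_cst|exact: csmooth_grad_mx].
move=> p; apply/continuous_mxP => i j; case: (split_ordP j) => l ->.
  rewrite (_ : (fun q => _) = fun q => complex.Re (cframe q i l)).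
    exact: (sc i l).1 0%N p I.
  by apply/funext => q; rewrite row_mxEl mxE.
rewrite (_ : (fun q => _) = fun q => complex.Im (cframe q i l)).
  exact: (sc i l).2 0%N p I.
by apply/funext => q; rewrite row_mxEr mxE.
Qed.

End AdaptedFrame.

(* m = n + 1 *)
Theorem theorem4p4 (R : realType) (n k : nat)
  (hm : (3 <= n.+1)%N) (hk : (k <= n)%N) (c : 'rV[R]_n.+1)
  (hc : forall j : 'I_n.+1, (j < k)%N -> 0 < c 0 j)
  (hcD : ~ (@Fmap R k n @` @Dset R k n) c) :
  exists o : Cspace R n.+1 -> set 'M[R]_(n.+1, n.+1 + n.+1),
    special_lagrangian k (@Fmap R k n @^-1` [set c]) o.
Proof.
have nD p : Fmap k p = c -> ~ Dset k p by move=> Fp Dp; apply: hcD; exists p.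
have sF := smooth_Fmap R hk.
have tangentP p v : Fmap k p = c ->
    tangent (@Fmap R k n @^-1` [set c]) p v <-> (v <= frame k p)%MS.
  move=> Fp; have kerE := frame_kerP hk (nD p Fp).
  by rewrite (tangent_level sF v Fp kerE) kerE.
(* A single global frame defines the orientation and also witnesses its continuity. *)
exists (fun p => [set A *m frame k p | A in [set A : 'M[R]_n.+1 | 0 < \det A]]).
split.
- split.
  + apply: submanifold_level => // p Fp; exists (frame k p).
    exact (frame_kerP hk (nD p Fp)).
  + move=> p u v Fp /(tangentP p u Fp) uE /(tangentP p v Fp) vE.
    have [G EG] := gram_frame_real hk p.
    exact (omega_frame EG uE vE).
  + move=> p u Fp /(tangentP p u Fp) uE H; have [G EG] := gram_frame_real hk p.
    apply: (gmetric_frame_nondeg (frame_unit hk (nD p Fp)) EG uE) => v vE.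
    by apply: H; apply/tangentP.
- move=> p Fp; split.
    exists (frame k p) => //; split; last by move=> v; exact: tangentP.
    have [G EG] := gram_frame_real hk p.
    exact: row_free_frame (frame_unit hk (nD p Fp)).
  exists setT, (frame k); split=> //; first exact: openT.
    by apply: continuous_subspaceT; exact: continuous_frame.
  by move=> q _ _; exists 1%:M; rewrite ?mul1mx //= det1 ltr01.
- move=> p e Fp [A /= A0 <-] L; have [G EG] := gram_frame_real hk p.
  (* Here t is [orient p], whose square is the value of [dz_wedge] on the frame. *)
  apply: (lorentz_frame_det EG _ (orient_neq0 hk (nD p Fp)) A0 L).
  by rewrite -det_cframe // -zmx_frame.
Qed.
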